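(* Consider the exponential random graph model (ERGM) on $n$ vertices with fixed graphs $H_1,\dots,H_k$ and parameters $\beta$ in the subcritical region, as in the context. Let $H$ be any fixed simple graph, possibly with isolated vertices, with $e=|\mathcal{E}(H)|\ge1$ edges and $v=|\mathcal{V}(H)|$ vertices. Then $$\mathbb{E}\Big||\mathrm{Hom}(H,G_Y,s)|-\mathbb{E}|\mathrm{Hom}(H,G_Y,s)|\Big|^3=O\big(n^{3v-\frac{15}{2}}\big),$$ that is, the left-hand side is at most $Cn^{3v-15/2}$ for all $n\ge2$ and all pairs $s=(i,j)$, $1\le i<j\le n$, with $C$ depending only on $\beta_1,\dots,\beta_k$, $H_1,\dots,H_k$ and $H$.
   Context: Graphs are simple (undirected, no loops or multiple edges). Let $k\ge1$; $H_1$ is a single edge, $H_2,\dots,H_k$ are fixed simple graphs without isolated vertices, each having at least two edges; $\beta_1\in\mathbb{R}$ and $\beta_2,\dots,\beta_k>0$. Let $v_j=|\mathcal{V}(H_j)|$ and $e_j$ be the numbers of vertices and edges of $H_j$. For graphs $H,G$, $|\mathrm{Hom}(H,G)|$ is the number of injective maps $\mathcal{V}(H)\to\mathcal{V}(G)$ sending every edge of $H$ to an edge of $G$. The ERGM is the random graph $G_Y$ on vertex set $\{1,\dots,n\}$ whose edge indicators $Y=(Y_{ij})_{1\le i<j\le n}\in\{0,1\}^{\binom n2}$ have probability mass function $$p_\beta(y)=\frac1{Z(\beta)}\exp\Big\{\sum_{j=1}^k\frac{\beta_j}{n^{v_j-2}}|\mathrm{Hom}(H_j,G_y)|\Big\},$$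 where $G_y$ is the graph with edge indicators $y$ and $Z(\beta)$ is the normalizing constant. Define $\Phi_\beta(a)=\sum_{i=1}^k\beta_ie_ia^{e_i-1}$ and $\varphi_\beta(a)=\frac{e^{2\Phi_\beta(a)}}{e^{2\Phi_\beta(a)}+1}$. The subcritical region is the set of $\beta$ for which the equation $\varphi_\beta(a)=a$ has a unique solution $p=p(\beta)$ in $(0,1)$ and $\varphi_\beta'(p)<1$. For a graph $G$ on $\{1,\dots,n\}$ and a pair $s=\{s_1,s_2\}$ of distinct vertices, $|\mathrm{Hom}(H,G,s)|$ is the number of injective maps $\mathcal{V}(H)\to\{1,\dots,n\}$ such that some edge of $H$ is mapped onto $s$ and every other edge of $H$ is mapped to an edge of $G$ (whether or not $s$ itself is an edge of $G$). *)

(* Defs.v *)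
From HB Require Import structures.
From mathcomp Require Import all_boot all_order all_algebra.
From mathcomp Require Import all_classical all_reals all_analysis.

Set Implicit Arguments.
Unset Strict Implicit.
Unset Printing Implicit Defensive.

Import Order.TTheory GRing.Theory Num.Theory.
Import numFieldNormedType.Exports.

Local Open Scope ring_scope.

(* An edge is a two-element set of vertices, so graphs are undirected, without
   loops and without multiple edges by construction. *)
Record sgraph := SGraph {
  vertices : finType;
  edges : {set {set vertices}};
  edges_card2 : {in edges, forall a : {set vertices}, #|a| = 2%N}
}.

Definition nv (G : sgraph) : nat := #|vertices G|.
Definition ne (G : sgraph) : nat := #|edges G|.

Definition no_isolated (G : sgraph) : Prop :=
  forall x : vertices G, exists2 a : {set vertices G}, a \in edges G & x \in a.

Definition is_single_edge (G : sgraph) : Prop := nv G = 2%N /\ ne G = 1%N.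

(* |Hom(H, G)| in the injective sense. *)
Definition nhom (H G : sgraph) : nat :=
  #|[set f : {ffun vertices H -> vertices G} |
      injectiveb f && [forall a in edges H, f @: a \in edges G]]|.

(* |Hom(H, G, s)|; membership of s in the edge set of G is irrelevant. *)
Definition nhom_at (H G : sgraph) (s : {set vertices G}) : nat :=
  #|[set f : {ffun vertices H -> vertices G} |
      injectiveb f &&
      [exists a in edges H, (f @: a == s) &&
        [forall b in edges H, (b != a) ==> (f @: b \in edges G)]]]|.
Arguments nhom_at : clear implicits.

Definition opair (n : nat) := {q : 'I_n * 'I_n | (q.1 < q.2)%N}.

Definition config (n : nat) := {ffun opair n -> bool}.

Definition config_edges (n : nat) (y : config n) : {set {set 'I_n}} :=
  [set [set (val q).1; (val q).2] | q : opair n & y q].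

Lemma config_edges_card2 (n : nat) (y : config n) :
  {in config_edges y, forall a : {set 'I_n}, #|a| = 2%N}.
Proof.
move=> a /imsetP[[[i j] /= ltij] _ ->] /=.
by rewrite cards2 neq_ltn ltij.
Qed.

Definition graph_of (n : nat) (y : config n) : sgraph :=
  SGraph (@config_edges_card2 n y).

Section ERGM.
Variables (R : realType) (k : nat) (Hs : 'I_k -> sgraph) (beta : 'I_k -> R).

(* The truncated subtraction is harmless for graphs with an edge. *)
Definition ergm_weight (n : nat) (y : config n) : R :=
  expR (\sum_(j < k)
    beta j / n%:R ^+ (nv (Hs j) - 2) * (nhom (Hs j) (graph_of y))%:R).

Definition ergm_Z (n : nat) : R := \sum_(y : config n) ergm_weight y.

Definition ergm_pmf (n : nat) (y : config n) : R := ergm_weight y / ergm_Z n.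

Definition ergm_E (n : nat) (X : config n -> R) : R :=
  \sum_(y : config n) ergm_pmf y * X y.

Definition Phi (a : R) : R :=
  \sum_(i < k) beta i * (ne (Hs i))%:R * a ^+ (ne (Hs i) - 1).

Definition phi (a : R) : R := expR (2 * Phi a) / (expR (2 * Phi a) + 1).

Definition subcritical : Prop :=
  exists p : R,
    [/\ 0 < p < 1, phi p = p,
        forall q : R, 0 < q < 1 -> phi q = q -> q = p &
        derive1 phi p < 1].

End ERGM.

(* Main.v *)
Require Import Defs.
From mathcomp Require Import all_boot all_order all_algebra.
From mathcomp Require Import all_classical all_reals all_analysis.
From mathcomp Require Import zify ring lra.

(* Given the rest of the configuration, an edge s is present with probability
   sigma_s = sigm(d_s), where d_s is a combination of the counts
   |Hom(H_j, G, s)|.  In such a count, replace every edge indicator by its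
   conditional probability, one at a time.  Each error is a sum of terms
   (y_t - sigma_t) g with g almost independent of y_t, so an exchangeable pair
   computation bounds the 2m-th moment of the total noise by O(n^{-m}); only the
   size O(1/n) of the influence of one edge on another matters, not
   subcriticality.

   Up to noise, d_s is therefore an increasing function of the sigma_t.  The
   largest sigma_t is then almost a sub-solution, and the smallest one almost a
   super-solution, of a = phi(a), and uniqueness of the fixed point p puts all of
   them near p unless the noise is large.  Near p the map sigma |-> sigm(d) is a
   contraction with rate close to phi'(p) < 1, which turns the noise bound into
   max_s E|sigma_s - p|^3 = O(n^{-3/2}), and the count for H inherits it. *)

(** Subcriticality controls the slope of [phi] only at [p]; elsewhere it may exceed 1, so the map on
    densities need not be a global contraction. Hence two stages: a monotone comparison, which rests
    on uniqueness of the fixed point, then a contraction in a neighbourhood of [p]. Monotonicity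
    survives a negative first coefficient because the count of a single edge at s is the same for
    all configurations.

    The stages use moments of different orders. The comparison needs small noise at all pairs at
    once, a union over at most n^2 events, and is paid for by eighth moments of the noise. The
    contraction runs on third moments directly.

    The mean of the count is never computed: the count is compared with the deterministic value 2 e
    p^{e-1} n^{v-2}, and recentring at the mean costs a constant factor. The exponent is 3(v-2) -
    3/2, since counts live on the scale n^{v-2} and, on that scale, deviate by O(n^{-1/2}) in third
    moment. *)

Set Implicit Arguments.
Unset Strict Implicit.
Unset Printing Implicit Defensive.

Import Order.TTheory GRing.Theory Num.Theory.
Import numFieldNormedType.Exports.

Local Open Scope ring_scope.

(** * Mean-field equation *)

Section Sigmoid.
Variable R : realType.
Implicit Types x y p eps : R.

Definition sigm x : R := expR x / (expR x + 1).

Let den_gt0 x : 0 < expR x + 1.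
Proof. by rewrite addr_gt0 // expR_gt0. Qed.

Lemma sigm_gt0 x : 0 < sigm x.
Proof. by rewrite divr_gt0 // expR_gt0. Qed.

Lemma sigmE x : sigm x = 1 - (expR x + 1)^-1.
Proof. by rewrite /sigm; field; rewrite gt_eqF. Qed.

Lemma sigm_lt1 x : sigm x < 1.
Proof. by rewrite sigmE gtrBl invr_gt0. Qed.

Lemma ler_sigm x y : x <= y -> sigm x <= sigm y.
Proof.
by move=> xy; rewrite !sigmE lerD2l lerN2 lef_pV2 ?posrE // lerD2r ler_expR.
Qed.

Lemma is_derive_sigm x : is_derive x 1 sigm (sigm x * (1 - sigm x)).
Proof.
have nz : expR x + 1 != 0 by rewrite gt_eqF.
have d : is_derive x 1 (fun z => expR z + 1 : R) (expR x + 0).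
  exact: is_deriveD.
have dV := @is_deriveV _ (fun z => expR z + 1) x _ 1 nz d.
have dM : is_derive x 1 sigm _ := is_deriveM (is_derive_expR x) dV.
apply: is_derive_eq dM _.
by rewrite /sigm /GRing.scale /=; field.
Qed.

Lemma sigm_continuous : continuous sigm.
Proof.
move=> x; apply/differentiable_continuous/derivable1_diffP.
by have := is_derive_sigm x; case.
Qed.

(** The derivative of [sigm] is a function of its value, so the mean value theorem needs a bound
    only for values between [sigm x] and [sigm y]. There are two hypotheses because the order of [x]
    and [y] is left open. *)
Lemma sigm_lip_within c x y :
  (forall z, sigm x <= sigm z <= sigm y -> sigm z * (1 - sigm z) <= c) ->
  (forall z, sigm y <= sigm z <= sigm x -> sigm z * (1 - sigm z) <= c) ->
  `|sigm x - sigm y| <= c * `|x - y|.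
Proof.
wlog xy : x y / x <= y.
  move=> wl h1 h2; case: (leP x y) => [xy|/ltW yx]; first exact: wl.
  by rewrite distrC (distrC x); apply: wl.
move=> h1 _; have [->|nxy] := eqVneq x y; first by rewrite !subrr normr0 mulr0.
have lxy : x < y by rewrite lt_neqAle nxy.
have cw : {within `[x, y], continuous sigm}%classic.
  by apply: continuous_subspaceT; exact: sigm_continuous.
have [z zxy E] := MVT lxy (fun z _ => is_derive_sigm z) cw.
rewrite distrC (distrC x) E normrM ler_wpM2r //.
rewrite ger0_norm; last by rewrite mulr_ge0 // ?subr_ge0 ltW // ?sigm_gt0 ?sigm_lt1.
apply: h1; move: zxy; rewrite in_itv /= => /andP[xz zy].
by rewrite !ler_sigm // ltW.
Qed.

Lemma sigm_lip x y : `|sigm x - sigm y| <= `|x - y|.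
Proof.
rewrite -[leRHS]mul1r; apply: sigm_lip_within => z _;
  have := sigm_gt0 z; have := sigm_lt1 z; nra.
Qed.

(** For a value a in [0,1] within [eps] of p, a(1-a) - p(1-p) = (a-p)(1-a-p) is at most [eps].
    Closeness is asked of the values, since the probabilities are what gets confined near p. *)
Lemma sigm_lip_near p eps x y : 0 <= p <= 1 ->
  `|sigm x - p| <= eps -> `|sigm y - p| <= eps ->
  `|sigm x - sigm y| <= (p * (1 - p) + eps) * `|x - y|.
Proof.
move=> p01 /ler_normlP[x1 x2] /ler_normlP[y1 y2].
apply: (@sigm_lip_within (p * (1 - p) + eps)) => z /andP[z1 z2];
  have := sigm_gt0 z; have := sigm_lt1 z; nra.
Qed.

End Sigmoid.

Section MeanField.
Local Open Scope classical_set_scope.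
Local Open Scope ring_scope.
Variables (R : realType) (k : nat) (Hs : 'I_k -> sgraph) (beta : 'I_k -> R).
Implicit Types a p eps : R.
Local Notation Phi := (Phi Hs beta).
Local Notation phi := (phi Hs beta).

Lemma phiE a : phi a = sigm (2 * Phi a).
Proof. by []. Qed.

Definition dPhi a : R := \sum_(i < k)
  beta i * (ne (Hs i))%:R * ((ne (Hs i) - 1)%N%:R * a ^+ (ne (Hs i) - 1).-1).

Lemma is_derive_Phi a : is_derive a 1 Phi (dPhi a).
Proof.
have h : is_derive a 1 (\sum_(i < k)
    ((beta i * (ne (Hs i))%:R) \*: ((@id R : R -> R) ^+ (ne (Hs i) - 1)))) (dPhi a).
  apply: is_derive_sum => i.
  have dX := @is_deriveX R R id (ne (Hs i) - 1) a 1 1 (is_derive_id a 1).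
  have dZ := @is_deriveZ R R R _ (beta i * (ne (Hs i))%:R) a 1 _ dX.
  by apply: is_derive_eq dZ _; rewrite /GRing.scale /= mulr1.
suff -> : Phi = \sum_(i < k)
    ((beta i * (ne (Hs i))%:R) \*: ((@id R : R -> R) ^+ (ne (Hs i) - 1))) by [].
by apply/funext => z; rewrite fct_sumE; apply: eq_bigr => i _; rewrite exprfctE.
Qed.

Lemma is_derive_phi a :
  is_derive a 1 phi (phi a * (1 - phi a) * (2 * dPhi a)).
Proof.
have d2 : is_derive a 1 (fun z : R => 2 *: (Phi z : R)) (2 *: (dPhi a : R)).
  exact: (is_deriveZ _ (is_derive_Phi a)).
exact: (is_derive1_comp (is_derive_sigm _) d2).
Qed.

Lemma phi_continuous : continuous phi.
Proof.
move=> x; apply/differentiable_continuous/derivable1_diffP.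
by have := is_derive_phi x; case.
Qed.

Lemma derive1_phi p : phi p = p -> derive1 phi p = p * (1 - p) * (2 * dPhi p).
Proof.
move=> pp; rewrite derive1E; have := is_derive_phi p; rewrite pp => h.
exact: derive_val.
Qed.

(** The slope of [phi] at its fixed point, with each of its two factors replaced by a bound valid
    when all densities are within [eps] of [p]. At [eps = 0] it is exactly [phi'(p)], so continuity
    keeps it below 1 for some positive [eps]. *)
Definition contraction_rate p eps : R := (p * (1 - p) + eps) * (2 * dPhi (p + eps)).

Lemma contraction_rate_lt1 p : phi p = p -> derive1 phi p < 1 ->
  exists2 eps, 0 < eps & contraction_rate p eps < 1.
Proof.
move=> pp d1.
have cadd (b : R) : (b + z) @[z --> (0 : R)] --> b + 0.
  by apply: cvgD; [exact: cvg_cst|exact: cvg_id].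
have cpow m : (p + z) ^+ m @[z --> (0 : R)] --> (p + 0) ^+ m.
  exact: (continuous_cvg _ (@exprn_continuous R m (p + 0)) (cadd p)).
have cdPhi : dPhi (p + z) @[z --> (0 : R)] --> dPhi (p + 0).
  rewrite /dPhi; elim: (index_enum _) => [|i r IH].
    by under eq_fun do rewrite big_nil; rewrite big_nil; exact: cvg_cst.
  under eq_fun do rewrite big_cons; rewrite big_cons.
  apply: cvgD; last exact: IH.
  by do 2!apply: cvgMl_tmp; exact: cpow.
have c : contraction_rate p z @[z --> (0 : R)] --> contraction_rate p 0.
  exact: (cvgM (cadd _) (cvgMl_tmp cdPhi)).
have r0 : contraction_rate p 0 < 1.
  by rewrite /contraction_rate !addr0 -derive1_phi.
have /nbhs_ballP[e e0 he] : \forall z \near (0 : R), contraction_rate p z < 1.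
  exact: (cvgr_lt _ c _ r0).
exists (e / 2); first by rewrite divr_gt0.
apply: he; rewrite /ball /= sub0r normrN gtr0_norm ?divr_gt0 //.
by have : 0 < e := e0; lra.
Qed.

Variable p : R.
Hypothesis phi_fix : forall q : R, 0 < q < 1 -> phi q = q -> q = p.

Let gapfun a := phi a - a.

Let gapfun_within a b : {within `[a, b], continuous gapfun}%classic.
Proof.
apply: continuous_subspaceT => x; apply: cvgB; last exact: cvg_id.
exact: phi_continuous.
Qed.

Let gapfun_zero q : gapfun q = 0 -> q = p.
Proof.
move=> /eqP; rewrite subr_eq0 => /eqP E; apply: phi_fix => //.
by rewrite -E phiE sigm_gt0 sigm_lt1.
Qed.

Lemma phi_gap_above eps : 0 < eps ->
  exists2 eta, 0 < eta & forall a, a <= 1 -> a <= phi a + eta -> a <= p + eps.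
Proof.
move=> eps0; have [pe|pe] := leP 1 (p + eps).
  by exists 1 => // a a1 _; lra.
have [c] := EVT_max (ltW pe) (@gapfun_within _ _).
rewrite in_itv /= => /andP[c1 c2] hc.
have gc : gapfun c < 0.
  rewrite ltNge; apply/negP => gc.
  have g1 : gapfun 1 <= 0 by rewrite subr_le0 phiE ltW // sigm_lt1.
  have [q] : exists2 q, q \in `[c, 1] & gapfun q = 0.
    by apply: IVT => //; rewrite ge_min le_max g1 gc orbT.
  by rewrite in_itv /= => /andP[cq _] /gapfun_zero; lra.
exists (- gapfun c / 2); first by rewrite divr_gt0 // oppr_gt0.
move=> a a1 h; rewrite leNgt; apply/negP => ha.
have := hc a; rewrite in_itv /= a1 (ltW ha) => /(_ isT).
by move: gc h; rewrite /gapfun; lra.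
Qed.

Lemma phi_gap_below eps : 0 < eps ->
  exists2 eta, 0 < eta & forall a, 0 <= a -> phi a - eta <= a -> p - eps <= a.
Proof.
move=> eps0; have [pe|pe] := leP (p - eps) 0.
  by exists 1 => // a a0 _; lra.
have [c] := EVT_min (ltW pe) (@gapfun_within _ _).
rewrite in_itv /= => /andP[c1 c2] hc.
have gc : 0 < gapfun c.
  rewrite ltNge; apply/negP => gc.
  have g1 : 0 <= gapfun 0 by rewrite subr_ge0 phiE ltW // sigm_gt0.
  have [q] : exists2 q, q \in `[0, c] & gapfun q = 0.
    by apply: IVT => //; rewrite ge_min le_max g1 gc orbT.
  by rewrite in_itv /= => /andP[_ qc] /gapfun_zero; lra.
exists (gapfun c / 2); first by rewrite divr_gt0.
move=> a a0 h; rewrite leNgt; apply/negP => ha.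
have := hc a; rewrite in_itv /= a0 (ltW ha) => /(_ isT).
by move: gc h; rewrite /gapfun; lra.
Qed.

End MeanField.

(** * Moments of the noise *)

Section Flip.
Variable T : finType.
Implicit Types (t u : T) (y : {ffun T -> bool}).

Definition flip t y : {ffun T -> bool} :=
  [ffun u => if u == t then ~~ y u else y u].

Lemma flipK t : involutive (flip t).
Proof.
move=> y; apply/ffunP => u; rewrite !ffunE.
by case: eqP => // _; rewrite negbK.
Qed.

Lemma flip_same t y : flip t y t = ~~ y t.
Proof. by rewrite ffunE eqxx. Qed.

Lemma flip_other t u y : u != t -> flip t y u = y u.
Proof. by rewrite ffunE => /negbTE ->. Qed.

End Flip.

Section PowerBounds.
Variable R : realType.
Implicit Types a b r x : R.

Lemma expr_add_le a b n : 0 <= a -> 0 <= b ->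
  (a + b) ^+ n <= 2 ^+ n * (a ^+ n + b ^+ n).
Proof.
move=> a0 b0; have [ab|ba] := leP a b.
- apply: (@le_trans _ _ ((2 * b) ^+ n)).
    by apply: lerXn2r; rewrite ?nnegrE; lra.
  by rewrite exprMn ler_wpM2l ?exprn_ge0 // lerDr exprn_ge0.
- apply: (@le_trans _ _ ((2 * a) ^+ n)).
    by apply: lerXn2r; rewrite ?nnegrE; lra.
  by rewrite exprMn ler_wpM2l ?exprn_ge0 // lerDl exprn_ge0.
Qed.

(** The bound avoids [b]: later [a] is the noise at [y] and [b] the noise after a flip, and only
    moments at [y] should appear. The factor [2 ^+ n] comes from expanding powers of |a| + r. *)
Lemma distr_expr_le a b r n : `|a - b| <= r ->
  `|a ^+ n.+1 - b ^+ n.+1| <= (n.+1%:R * 2 ^+ n) * r * (`|a| ^+ n + r ^+ n).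
Proof.
move=> abr; have r0 : 0 <= r by apply: le_trans abr.
have br : `|b| <= `|a| + r.
  by rewrite -[b](subKr a) (le_trans (ler_normB _ _)) // lerD2l.
rewrite subrXX normrM.
have sumle : `|\sum_(i < n.+1) a ^+ (n.+1.-1 - i) * b ^+ i|
    <= n.+1%:R * (`|a| + r) ^+ n.
  rewrite (le_trans (ler_norm_sum _ _ _)) //.
  rewrite mulr_natl -[n.+1 in leRHS]card_ord -sumr_const.
  apply: ler_sum => i _; rewrite normrM !normrX.
  have -> : (`|a| + r) ^+ n = (`|a| + r) ^+ (n - i) * (`|a| + r) ^+ i.
    by rewrite -exprD subnK // -ltnS.
  by apply: ler_pM; rewrite ?exprn_ge0 //; apply: lerXn2r;
    rewrite ?nnegrE ?addr_ge0 // lerDl.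
apply: (le_trans (ler_pM _ _ abr sumle)) => //.
have -> : n.+1%:R * 2 ^+ n * r * (`|a| ^+ n + r ^+ n) =
  r * (n.+1%:R * (2 ^+ n * (`|a| ^+ n + r ^+ n))) by ring.
by do 2!rewrite ler_wpM2l //; exact: expr_add_le.
Qed.

End PowerBounds.

Section ProdBounds.
Variables (R : realType) (T : eqType).
Implicit Types (s : seq T) (f g : T -> R).

Lemma prodr_unit_itv s f : (forall t, 0 <= f t <= 1) ->
  0 <= \prod_(t <- s) f t <= 1.
Proof.
move=> f01; elim: s => [|t s /andP[h0 h1]]; first by rewrite big_nil ler01 lexx.
have /andP[t0 t1] := f01 t.
by rewrite big_cons mulr_ge0 //= mulr_ile1.
Qed.

(** Factors are exchanged one at a time, the others being bounded by [b]. Keeping [b] rather than 1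
    is what later yields the sharp contraction rate, with [b] close to the fixed point. For empty
    [s] both sides vanish, so the truncated exponent is harmless. *)
Lemma distr_prod_le s f g b :
  (forall t, 0 <= f t <= b) -> (forall t, 0 <= g t <= b) ->
  `|\prod_(t <- s) f t - \prod_(t <- s) g t| <=
  b ^+ (size s).-1 * \sum_(t <- s) `|f t - g t|.
Proof.
move=> fb gb.
have prodb s' : 0 <= \prod_(t <- s') f t <= b ^+ size s'.
  elim: s' => [|t s' /andP[h0 h1]]; first by rewrite !big_nil expr0 ler01 lexx.
  have /andP[t0 t1] := fb t.
  by rewrite big_cons exprS mulr_ge0 //= ler_pM.
elim: s => [|t s IH]; first by rewrite !big_nil subrr normr0 mulr0.
rewrite !big_cons /=.
have -> : f t * \prod_(j <- s) f j - g t * \prod_(j <- s) g j =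
   (f t - g t) * \prod_(j <- s) f j +
   g t * (\prod_(j <- s) f j - \prod_(j <- s) g j) by ring.
rewrite (le_trans (ler_normD _ _)) // [leRHS]mulrDr.
have /andP[p0 p1] := prodb s.
have /andP[g0 g1] := gb t.
apply: lerD.
  by rewrite normrM (ger0_norm p0) mulrC ler_wpM2r.
rewrite normrM (ger0_norm g0).
case: s IH {p0 p1} => [|u s] IH.
  by rewrite !big_nil subrr normr0 !mulr0.
apply: (le_trans (ler_pM _ _ g1 IH)) => //.
by rewrite mulrA -exprS.
Qed.

End ProdBounds.

Section Noise.
Variables (R : realType) (T : finType).
Local Notation config := {ffun T -> bool}.
Variables (P : config -> R) (sigma : T -> config -> R).
Hypothesis P_ge0 : forall y, 0 <= P y.
Hypothesis P_sum1 : \sum_y P y = 1.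

Definition expect (X : config -> R) : R := \sum_y P y * X y.

Local Notation E := expect.

Lemma eq_expect X Y : X =1 Y -> E X = E Y.
Proof. by move=> XY; apply: eq_bigr => y _; rewrite XY. Qed.

Lemma expectD X Y : E (fun y => X y + Y y) = E X + E Y.
Proof. by rewrite /E -big_split; apply: eq_bigr => y _; rewrite mulrDr. Qed.

Lemma expectZ c X : E (fun y => c * X y) = c * E X.
Proof. by rewrite /E mulr_sumr; apply: eq_bigr => y _; rewrite mulrCA. Qed.

Lemma expect_cst c : E (fun=> c) = c.
Proof. by rewrite /E -mulr_suml P_sum1 mul1r. Qed.

Lemma expect_sum (I : Type) (r : seq I) (Q : pred I) (X : I -> config -> R) :
  E (fun y => \sum_(i <- r | Q i) X i y) = \sum_(i <- r | Q i) E (X i).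
Proof.
rewrite /E exchange_big; apply: eq_bigr => y _; by rewrite mulr_sumr.
Qed.

Lemma le_expect X Y : (forall y, X y <= Y y) -> E X <= E Y.
Proof. by move=> XY; apply: ler_sum => y _; rewrite ler_wpM2l. Qed.

Lemma expect_ge0 X : (forall y, 0 <= X y) -> 0 <= E X.
Proof. by move=> X0; apply: sumr_ge0 => y _; rewrite mulr_ge0. Qed.

Lemma norm_expect X : `|E X| <= E (fun y => `|X y|).
Proof.
rewrite (le_trans (ler_norm_sum _ _ _)) //; apply: ler_sum => y _.
by rewrite normrM (ger0_norm (P_ge0 y)).
Qed.

Local Notation ind b := ((nat_of_bool b)%:R : R).

Hypothesis sigma01 : forall t y, 0 <= sigma t y <= 1.
Hypothesis sigma_flip : forall t y, sigma t (flip t y) = sigma t y.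
(** Detailed balance on the two-point fibre of [y] and [flip t y]: [sigma t] is the conditional
    probability of [y t] given the other coordinates. *)
Hypothesis balance : forall t y,
  P y * (ind (y t) - sigma t y) +
  P (flip t y) * (ind (flip t y t) - sigma t y) = 0.

(** The sum over configurations is added to its reindexing by the involution [flip t]; the terms
    then cancel pairwise by [balance]. *)
Lemma expect_flip_invariant t X : (forall y, X (flip t y) = X y) ->
  E (fun y => (ind (y t) - sigma t y) * X y) = 0.
Proof.
move=> Xf; set F := fun y => P y * ((ind (y t) - sigma t y) * X y).
have h : \sum_y F y = \sum_y F (flip t y).
  by rewrite (reindex_inj (inv_inj (@flipK _ t))).
suff : \sum_y F y + \sum_y F y = 0 by rewrite /expect -/F; lra.
rewrite {2}h -big_split big1 //= => y _; rewrite /F Xf sigma_flip !mulrA -mulrDl.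
by rewrite balance mul0r.
Qed.

Lemma norm_expect_flip t X :
  `|E (fun y => (ind (y t) - sigma t y) * X y)| <=
  E (fun y => `|X y - X (flip t y)|).
Proof.
(* [Z] does not depend on [y t], hence does not contribute. *)
set Z := fun y => (X y + X (flip t y)) / 2.
have ZE : E (fun y => (ind (y t) - sigma t y) * Z y) = 0.
  by apply: expect_flip_invariant => y; rewrite /Z flipK addrC.
rewrite -[X in `|X|]subr0 -ZE -[X in _ - X]mul1r -mulNr -expectZ -expectD.
apply: (le_trans (norm_expect _)); apply: le_expect => y.
rewrite mulN1r -mulrBr normrM /Z.
have -> : X y - (X y + X (flip t y)) / 2 = (X y - X (flip t y)) / 2 by field.
rewrite normrM.
have h1 : `|ind (y t) - sigma t y| <= 1.
  have /andP[] := sigma01 t y; case: (y t) => /= s0 s1.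
    by rewrite ger0_norm; lra.
  by rewrite ler_norml; lra.
have h2 : `|2^-1 : R| <= 1 by rewrite ger0_norm; lra.
rewrite mulrCA -[leRHS]mulr1 ler_wpM2l // mulr_ile1 //.
Qed.

Variables (alpha : R).
Hypothesis sigma_lip : forall t u y, `|sigma u y - sigma u (flip t y)| <= alpha.

Lemma alpha_ge0 (t : T) : 0 <= alpha.
Proof. exact: (le_trans (normr_ge0 _) (sigma_lip t t [ffun=> false])). Qed.

Lemma prod_sigma_flip s t y :
  `|\prod_(u <- s) sigma u y - \prod_(u <- s) sigma u (flip t y)|
    <= (size s)%:R * alpha.
Proof.
have := distr_prod_le s (fun u => sigma01 u y) (fun u => sigma01 u (flip t y)).
rewrite expr1n mul1r => /le_trans; apply.
rewrite mulr_natl -[size s]count_predT -sum1_count.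
rewrite -[alpha]mulr1 -mulrnAr (natr_sum R) mulr_sumr.
by apply: ler_sum => u _; rewrite mulr1.
Qed.

(** Induction peels one coordinate t: the factor [ind (y t) - sigma t y] multiplies a quantity [G]
    that t can influence only through the remaining [sigma] factors and through [X]. [Q] collects
    the indicators already peeled; it does not react to the coordinates left in [s] because [s] has
    no repetition. *)
Lemma telescope_noise (s : seq T) (Q X : config -> R) (B0 B1 : R) :
  uniq s -> (forall y, `|Q y| <= 1) ->
  (forall t y, t \in s -> Q (flip t y) = Q y) ->
  E (fun y => `|X y|) <= B0 ->
  (forall t, E (fun y => `|X y - X (flip t y)|) <= B1) ->
  `|E (fun y => Q y * (\prod_(u <- s) ind (y u) - \prod_(u <- s) sigma u y)
                * X y)|
    <= (size s)%:R * ((size s)%:R * alpha * B0 + B1).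
Proof.
move=> us Q1 Qf XB0 XB1; elim: s Q us Q1 Qf => [|t s IH] Q /= => [_ _ _|].
  rewrite mul0r (_ : expect _ = 0) ?normr0 //.
  by rewrite /expect big1 // => y _; rewrite !big_nil subrr mulr0 mul0r mulr0.
move=> /andP[ts us] Q1 Qf.
have a0 := alpha_ge0 t.
have B00 : 0 <= B0 by apply: le_trans XB0; apply: expect_ge0.
have B10 : 0 <= B1 by apply: le_trans (XB1 t); apply: expect_ge0.
pose G y := Q y * \prod_(u <- s) sigma u y * X y.
pose Q' y := Q y * ind (y t).
rewrite (@eq_expect _ (fun y => (ind (y t) - sigma t y) * G y +
   Q' y * (\prod_(u <- s) ind (y u) - \prod_(u <- s) sigma u y) * X y)); last first.
  by move=> y; rewrite !big_cons /G /Q'; ring.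
rewrite expectD (le_trans (ler_normD _ _)) //.
have h1 : `|E (fun y => (ind (y t) - sigma t y) * G y)| <=
    (size s)%:R * alpha * B0 + B1.
  apply: (le_trans (norm_expect_flip _ _)).
  apply: (@le_trans _ _ (E (fun y => (size s)%:R * alpha * `|X y| +
      `|X y - X (flip t y)|))).
    apply: le_expect => y; rewrite /G Qf ?mem_head //.
    set p := \prod_(u <- s) _; set q := \prod_(u <- s) _.
    have -> : Q y * p * X y - Q y * q * X (flip t y) =
      Q y * ((p - q) * X y + q * (X y - X (flip t y))) by ring.
    rewrite normrM -[leRHS]mul1r ler_pM // (le_trans (ler_normD _ _)) //.
    rewrite !normrM; apply: lerD.
      by rewrite ler_wpM2r // prod_sigma_flip.
    have /andP[q0 q1] : 0 <= q <= 1 by apply: prodr_unit_itv => u; exact: sigma01.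
    by rewrite -[leRHS]mul1r ler_wpM2r // ger0_norm.
  rewrite expectD expectZ lerD // ler_wpM2l // mulr_ge0 //.
have h2 := IH Q' us.
have {h2} : `|E (fun y => Q' y *
    (\prod_(u <- s) ind (y u) - \prod_(u <- s) sigma u y) * X y)| <=
    (size s)%:R * ((size s)%:R * alpha * B0 + B1).
  apply: h2 => [y|u y us'].
    rewrite /Q' normrM mulr_ile1 //.
    by case: (y t); rewrite ?normr1 ?normr0.
  rewrite /Q' Qf ?in_cons ?us' ?orbT // flip_other //.
  by apply: contraNneq ts => ->.
move=> h2; apply: (le_trans (lerD h1 h2)).
rewrite -[in leRHS]natr1.
have : 0 <= (size s)%:R :> R by [].
move: (size s)%:R => m m0.
have : 0 <= m * alpha * B0 by rewrite !mulr_ge0.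
have : 0 <= alpha * B0 by rewrite !mulr_ge0.
set z := alpha * B0; rewrite -!mulrA -/z => z0 mz0.
nra.
Qed.

(** In the application [D] selects the placements of a graph at a pair, [tau] lists the pairs
    covered by its other edges, [w] is n^{-(v-2)} and [delta] is 1/n. A single constant [A] governs
    the total weight, the weight through one coordinate and the influence on [sigma], so moment
    bounds can be uniform in n. *)
Variables (I : finType) (D : pred I) (tau : I -> seq T) (w : R) (m0 : nat).
Variables (A delta : R).
Hypothesis tau_uniq : forall i, D i -> uniq (tau i).
Hypothesis tau_size : forall i, D i -> (size (tau i) <= m0)%N.
Hypothesis w_ge0 : 0 <= w.
Hypothesis A_ge0 : 0 <= A.
Hypothesis delta01 : 0 <= delta <= 1.
Hypothesis card_D : w * #|D|%:R <= A.
Hypothesis card_D_mem :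
  forall t, w * #|[pred i | D i && (t \in tau i)]|%:R <= A * delta.
Hypothesis alpha_le : alpha <= A * delta.

Definition noise (y : config) : R :=
  w * \sum_(i | D i)
    (\prod_(u <- tau i) ind (y u) - \prod_(u <- tau i) sigma u y).

(** The first term accounts for the indicator products, which change only for sequences through the
    flipped coordinate; the second for the [sigma] products, each of which moves by at most
    [m0%:R * alpha]. *)
Definition noise_lip : R := A + m0%:R * A * A.

Let sumD (c : R) : \sum_(i | D i) c = #|D|%:R * c.
Proof. by rewrite mulr_natl -sumr_const; apply: eq_bigl => i. Qed.

Lemma noise_bound y : `|noise y| <= A.
Proof.
rewrite normrM ger0_norm // (le_trans _ card_D) // ler_wpM2l //.
rewrite -[X in _ <= X]mulr1 -sumD (le_trans (ler_norm_sum _ _ _)) //.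
apply: ler_sum => i _.
have /andP[a0 a1] : 0 <= \prod_(u <- tau i) ind (y u) <= 1.
  by apply: prodr_unit_itv => u; case: (y u); rewrite lexx ler01.
have /andP[b0 b1] : 0 <= \prod_(u <- tau i) sigma u y <= 1.
  by apply: prodr_unit_itv => u; exact: sigma01.
by rewrite ler_norml; lra.
Qed.

Lemma noise_flip t y : `|noise y - noise (flip t y)| <= noise_lip * delta.
Proof.
have a0 := alpha_ge0 t; case/andP: delta01 => d0 d1.
rewrite /noise -mulrBr -sumrB normrM ger0_norm //.
apply: (@le_trans _ _ (w * \sum_(i | D i) (ind (t \in tau i) + m0%:R * alpha))).
  rewrite ler_wpM2l // (le_trans (ler_norm_sum _ _ _)) //; apply: ler_sum => i Di.
  set a := \prod_(u <- tau i) _; set b := \prod_(u <- tau i) _.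
  set c := \prod_(u <- tau i) _; set d := \prod_(u <- tau i) _.
  have -> : a - b - (c - d) = (a - c) - (b - d) by ring.
  rewrite (le_trans (ler_normB _ _)) //; apply: lerD.
    have [ti|ti] := boolP (t \in tau i); last first.
      rewrite /a /c (_ : \prod_(u <- tau i) ind (flip t y u) = a) ?subrr ?normr0 //.
      rewrite /a !big_seq; apply: eq_bigr => u us; rewrite flip_other //.
      by apply: contraNneq ti => <-.
    have /andP[] : 0 <= a <= 1.
      by apply: prodr_unit_itv => u; case: (y u); rewrite lexx ler01.
    have /andP[] : 0 <= c <= 1.
      by apply: prodr_unit_itv => u; case: (flip t y u); rewrite lexx ler01.
    by move=> *; rewrite mulr1n ler_norml; lra.
  apply: (le_trans (prod_sigma_flip _ _ _)).
  by rewrite ler_wpM2r // ler_nat tau_size.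
rewrite big_split /= mulrDr sumD.
have -> : \sum_(i | D i) ind (t \in tau i) =
    #|[pred i | D i && (t \in tau i)]|%:R.
  by rewrite -sum1_card natr_sum big_mkcondr /=; apply: eq_bigr => i _;
    case: (t \in tau i).
rewrite mulrDl lerD //.
have -> : w * (#|D|%:R * (m0%:R * alpha)) = (w * #|D|%:R) * (m0%:R * alpha) by ring.
have -> : m0%:R * A * A * delta = A * (m0%:R * (A * delta)) by ring.
by apply: ler_pM; rewrite ?mulr_ge0 ?ler_wpM2l.
Qed.

(** One factor of the even power is expanded by definition and telescoped against the remaining odd
    power [X]. A flip changes [X] by O(delta) times a power of order 2m, so two powers of the noise
    are traded for one factor [delta]. *)
Lemma noise_moment_step m :
  E (fun y => noise y ^+ m.+1.*2) <=
  m0%:R * A * (m0%:R * A * A + ((m.*2.+1)%:R * 2 ^+ m.*2) * noise_lip) * delta *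
    (E (fun y => noise y ^+ m.*2) + (noise_lip * delta) ^+ m.*2).
Proof.
case/andP: delta01 => d0 d1.
set K := _ * 2 ^+ _; set r := noise_lip * delta.
set EM := E (fun y => noise y ^+ m.*2).
have lip0 : 0 <= noise_lip by rewrite addr_ge0 // !mulr_ge0.
have r0 : 0 <= r by rewrite mulr_ge0.
have K0 : 0 <= K by rewrite mulr_ge0 // exprn_ge0.
have EM0 : 0 <= EM.
  by apply: expect_ge0 => y; rewrite -mul2n exprM exprn_ge0 // sqr_ge0.
have norm_even y : `|noise y| ^+ m.*2 = noise y ^+ m.*2.
  by rewrite -normrX ger0_norm // -mul2n exprM exprn_ge0 // sqr_ge0.
pose X y := noise y ^+ m.*2.+1.
have XB0 : E (fun y => `|X y|) <= A * EM.
  rewrite -expectZ; apply: le_expect => y.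
  rewrite /X normrX exprS norm_even ler_wpM2r ?noise_bound //.
  by rewrite -norm_even exprn_ge0.
have XB1 t : E (fun y => `|X y - X (flip t y)|) <= K * r * (EM + r ^+ m.*2).
  rewrite mulrDr -expectZ -(expect_cst (K * r * r ^+ m.*2)) -expectD.
  apply: le_expect => y; rewrite -mulrDr -norm_even.
  exact: distr_expr_le (noise_flip t y).
rewrite (@eq_expect _ (fun y => w * \sum_(i | D i) (1 *
    (\prod_(u <- tau i) ind (y u) - \prod_(u <- tau i) sigma u y) * X y))); last first.
  move=> y; rewrite doubleS exprS -/(X y) {1}/noise -mulrA mulr_suml.
  by congr (_ * _); apply: eq_bigr => i _; rewrite mul1r.
rewrite expectZ expect_sum.
apply: (@le_trans _ _ (w * \sum_(i | D i)
    (m0%:R * (m0%:R * (A * delta) * (A * EM) + K * r * (EM + r ^+ m.*2))))).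
  rewrite ler_wpM2l //; apply: ler_sum => i Di.
  apply: (le_trans (ler_norm _)).
  apply: (le_trans (@telescope_noise (tau i) (fun=> 1) X _ _ (tau_uniq Di) _ _ XB0 XB1)) => //.
    by move=> y; rewrite normr1.
  have sm : (size (tau i))%:R <= m0%:R :> R by rewrite ler_nat tau_size.
  apply: ler_pM => //.
    apply: addr_ge0; last by rewrite !(mulr_ge0, addr_ge0) // exprn_ge0.
    have := alpha_ge0.
    case: (tau i) => [|t s] /=; first by rewrite mul0r mul0r.
    by move=> /(_ t) a0; rewrite !mulr_ge0.
  rewrite lerD2r ler_wpM2r ?mulr_ge0 //.
  case: (tau i) sm => [|t s] /= sm; first by rewrite mul0r !mulr_ge0.
  by apply: ler_pM => //; exact: alpha_ge0.
rewrite sumD mulrA.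
have r2 : 0 <= r ^+ m.*2 by rewrite exprn_ge0.
apply: (@le_trans _ _ (A * (m0%:R * (m0%:R * (A * delta) * (A * EM) + K * r * (EM + r ^+ m.*2))))).
  rewrite ler_wpM2r // !(mulr_ge0, addr_ge0) //.
rewrite /r in r2 *; move: r2; set z := (_ * _) ^+ _ => r2.
have -> : A * (m0%:R * (m0%:R * (A * delta) * (A * EM) +
     K * (noise_lip * delta) * (EM + z))) =
   (m0%:R * A * delta) * (m0%:R * A * A * EM + K * noise_lip * (EM + z)) by ring.
have -> : m0%:R * A * (m0%:R * A * A + K * noise_lip) * delta * (EM + z) =
   (m0%:R * A * delta) * (m0%:R * A * A * (EM + z) + K * noise_lip * (EM + z)) by ring.
rewrite ler_wpM2l ?mulr_ge0 // lerD2r ler_wpM2l ?mulr_ge0 //.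
by rewrite lerDl.
Qed.

End Noise.

(* Only the scale [delta] of the influences enters, not their contraction. *)
Lemma noise_moment (R : realType) (m0 : nat) (A : R) (m : nat) : 0 <= A ->
  exists2 C : R, 0 <= C &
  forall (T : finType) (P : {ffun T -> bool} -> R)
    (sigma : T -> {ffun T -> bool} -> R) (alpha : R)
    (I : finType) (D : pred I) (tau : I -> seq T) (w delta : R),
  (forall y, 0 <= P y) -> \sum_y P y = 1 ->
  (forall t y, 0 <= sigma t y <= 1) ->
  (forall t y, sigma t (flip t y) = sigma t y) ->
  (forall t y, P y * ((y t)%:R - sigma t y) +
     P (flip t y) * ((flip t y t)%:R - sigma t y) = 0) ->
  (forall t u y, `|sigma u y - sigma u (flip t y)| <= alpha) ->
  (forall i, D i -> uniq (tau i)) -> (forall i, D i -> (size (tau i) <= m0)%N) ->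
  0 <= w -> 0 <= delta <= 1 ->
  w * #|D|%:R <= A ->
  (forall t, w * #|[pred i | D i && (t \in tau i)]|%:R <= A * delta) ->
  alpha <= A * delta ->
  expect P (fun y => noise sigma D tau w y ^+ m.*2) <= C * delta ^+ m.
Proof.
move=> A0; elim: m => [|m [C C0 IH]].
  exists 1 => // T P sigma alpha I D tau w delta P0 P1 *.
  rewrite (_ : expect _ _ = 1) ?mulr1 // -[RHS](expect_cst P1).
  by apply: eq_expect => y; rewrite expr0.
set L := noise_lip m0 A.
have L0 : 0 <= L by rewrite addr_ge0 // !mulr_ge0.
pose B := m0%:R * A * (m0%:R * A * A + ((m.*2.+1)%:R * 2 ^+ m.*2) * L).
have B0 : 0 <= B by rewrite !(mulr_ge0, addr_ge0) // exprn_ge0.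
exists (B * (C + L ^+ m.*2)); first by rewrite !(mulr_ge0, addr_ge0) // exprn_ge0.
move=> T P sigma alpha I D tau w delta P0 P1 s01 sf bal lip tu ts w0 d01 cD cDm al.
have /andP[d0 d1] := d01.
have := @noise_moment_step R T P sigma P0 P1 s01 sf bal alpha lip I D tau w m0
  A delta tu ts w0 A0 d01 cD cDm al m.
rewrite -/L -/B => /le_trans; apply.
have -> : B * (C + L ^+ m.*2) * delta ^+ m.+1 =
    B * delta * (C * delta ^+ m + L ^+ m.*2 * delta ^+ m) by rewrite exprS; ring.
apply: ler_wpM2l; first exact: mulr_ge0.
apply: lerD; first exact: (IH _ _ _ alpha).
rewrite exprMn ler_wpM2l ?exprn_ge0 // -addnn exprD.
by rewrite -[leRHS]mulr1 ler_wpM2l ?exprn_ge0 // exprn_ile1.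
Qed.

(** * Counting placements *)

Lemma eq_set2 (T : finType) (p q i j : T) : i != j ->
  ([set p; q]%SET == [set i; j]%SET) =
  (p == i) && (q == j) || (p == j) && (q == i).
Proof.
move=> nij; apply/eqP/orP => [E|[]/andP[/eqP-> /eqP->] //]; last first.
  by rewrite finset.setUC.
have : i \in [set p; q]%SET by rewrite E set21.
have : j \in [set p; q]%SET by rewrite E set22.
have : p \in [set i; j]%SET by rewrite -E set21.
have : q \in [set i; j]%SET by rewrite -E set22.
rewrite !inE => hq hp /orP[]/eqP Ej /orP[]/eqP Ei.
- by rewrite Ei Ej eqxx in nij.
- by rewrite Ei Ej !eqxx; right.
- by rewrite Ei Ej !eqxx; left.
- by rewrite Ei Ej eqxx in nij.
Qed.

Section Counting.
Variables (V : finType) (n : nat).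
Local Open Scope nat_scope.
Implicit Types (f g : {ffun V -> 'I_n}) (a : {set V}) (s t : {set 'I_n}).

(** Multiplied out, here and in the counts below, so that the saved powers of n require neither
    division nor a subtraction in the exponent. *)
Lemma card_ffun_prescribed (r : seq V) (g : V -> 'I_n) : uniq r ->
  #|[pred f : {ffun V -> 'I_n} | all (fun x => f x == g x) r]| * n ^ size r =
  n ^ #|V|.
Proof.
move=> ur; pose F x : pred 'I_n := if x \in r then pred1 (g x) else predT.
rewrite (@eq_card _ _ (family F)); last first.
  move=> f; rewrite inE; apply/allP/familyP => [h x|h x xr].
    by rewrite /F; case: ifP => // xr; exact: (h _ xr).
  by have := h x; rewrite /F xr inE.
rewrite card_family foldrE big_map big_enum /=.
rewrite (bigID (mem r)) /= big1 ?mul1n; last first.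
  by move=> x xr; rewrite /F xr card1.
rewrite (eq_bigr (fun=> n)); last first.
  by move=> x /negbTE xr; rewrite /F xr card_ord.
rewrite prod_nat_const -expnD; congr (_ ^ _).
by rewrite -(card_uniqP ur) addnC cardC.
Qed.

(** The factor 2 counts the two orientations in which the ends of [a] can be sent onto [s]; each
    orientation prescribes two further values. *)
Lemma card_imset_prescribed (r : seq V) (g : V -> 'I_n) a s :
  uniq r -> #|a| = 2 -> #|s| = 2 -> {in r, forall x, x \notin a} ->
  #|[pred f : {ffun V -> 'I_n} | (f @: a == s) && all (fun x => f x == g x) r]|
    * n ^ (size r).+2 = 2 * n ^ #|V|.
Proof.
move=> ur a2 s2 ra.
have /cards2P[x1 [x2 [nx Ea]]] : #|a| == 2 by rewrite a2.
have /cards2P[i [j [nij Es]]] : #|s| == 2 by rewrite s2.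
subst a s; clear a2 s2.
pose gg p q x := if x == x1 then p else if x == x2 then q else g x.
pose A p q := [pred f : {ffun V -> 'I_n} |
  all (fun x => f x == gg p q x) [:: x1, x2 & r]].
have nr x : x \in r -> (x == x1 = false) * (x == x2 = false).
  by move=> /ra; rewrite !inE negb_or => /andP[/negbTE -> /negbTE ->].
have AE p q f : A p q f =
    [&& f x1 == p, f x2 == q & all (fun x => f x == g x) r].
  rewrite /A /= /gg eqxx (eq_sym x2) (negbTE nx) eqxx; congr [&& _, _ & _].
  by apply: eq_in_all => x /nr [-> ->].
have cA p q : #|A p q| * n ^ (size r).+2 = n ^ #|V|.
  rewrite -[(size r).+2]/(size [:: x1, x2 & r]) card_ffun_prescribed //.
  rewrite /= ur !inE negb_or nx !andbT /=.
  by apply/andP; split; apply/negP => /nr [] //; rewrite eqxx.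
rewrite (@eq_card _ _ [predU A i j & A j i]); last first.
  move=> f; rewrite !inE -![all _ (x1 :: _)]/(A _ _ f) !AE.
  rewrite imsetU1 imset_set1 [in RHS]andbA [X in _ || X]andbA -andb_orl.
  by rewrite eq_set2.
have := cardUI (A i j) (A j i).
rewrite (@eq_card0 _ [predI A i j & A j i]) ?addn0; last first.
  move=> f; rewrite !inE -![all _ (x1 :: _)]/(A _ _ f) !AE.
  apply/negP => /andP[/andP[/eqP -> _] /andP[/eqP ij _]].
  by rewrite ij eqxx in nij.
by move=> ->; rewrite mulnDl !cA addnn mul2n.
Qed.

Lemma card_imset_eq a s : #|a| = 2 -> #|s| = 2 ->
  #|[pred f : {ffun V -> 'I_n} | f @: a == s]| = 2 * n ^ (#|V| - 2).
Proof.
move=> a2 s2; have [i _] : exists i, i \in s by apply/card_gt0P; rewrite s2.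
have := @card_imset_prescribed [::] (fun=> i) a s isT a2 s2 (fun _ => ltac:(done)).
have V2 : 2 <= #|V| by rewrite -a2 max_card.
rewrite -[in n ^ #|V|](subnK V2) expnD mulnA => /eqP.
have n0 : 0 < n ^ 2 by rewrite expn_gt0 (leq_trans _ (ltn_ord i)).
rewrite eqn_pmul2r // => /eqP <-.
by apply: eq_card => f; rewrite !inE andbT.
Qed.

Lemma card_imset_eq_at a s x c : #|a| = 2 -> #|s| = 2 -> x \notin a ->
  #|[pred f : {ffun V -> 'I_n} | (f @: a == s) && (f x == c)]| * n =
  2 * n ^ (#|V| - 2).
Proof.
move=> a2 s2 xa.
have := @card_imset_prescribed [:: x] (fun=> c) a s isT a2 s2.
have ra : {in [:: x], forall z, z \notin a} by move=> z; rewrite inE => /eqP ->.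
have V2 : 2 <= #|V| by rewrite -a2 max_card.
move=> /(_ ra); rewrite -[in n ^ #|V|](subnK V2) expnD mulnA expnS mulnA => /eqP.
have n0 : 0 < n ^ 2 by rewrite expn_gt0 (leq_trans _ (ltn_ord c)).
rewrite eqn_pmul2r // => /eqP <-; congr (_ * _).
by apply: eq_card => f; rewrite !inE /= andbT.
Qed.

Lemma card_imset_eq_mem a s t x : #|a| = 2 -> #|s| = 2 -> #|t| = 2 ->
  x \notin a ->
  #|[pred f : {ffun V -> 'I_n} | (f @: a == s) && (f x \in t)]| * n =
  4 * n ^ (#|V| - 2).
Proof.
move=> a2 s2 t2 xa.
rewrite -sum1_card.
rewrite (eq_bigl (fun f : {ffun V -> 'I_n} => (f @: a == s) && (f x \in t))) //.
rewrite (partition_big (fun f : {ffun V -> 'I_n} => f x) (mem t)) /=; last first.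
  by move=> f /andP[].
rewrite big_distrl /= (eq_bigr (fun=> 2 * n ^ (#|V| - 2))); last first.
  move=> c ct; rewrite -(card_imset_eq_at c a2 s2 xa) -sum1_card.
  congr (_ * _); apply: eq_bigl => f; rewrite !inE -andbA; congr (_ && _).
  by case: eqP => [->|]; rewrite ?andbF // andbT.
by rewrite sum_nat_const t2 mulnA.
Qed.

(** A map sending [a] onto [s] is injective on [a], so of two colliding vertices at least one lies
    outside [a]. Its value is dictated by the other vertex, which saves a factor n for each pair of
    vertices. *)
Lemma card_imset_noninj a s : #|a| = 2 -> #|s| = 2 ->
  #|[pred f : {ffun V -> 'I_n} | (f @: a == s) && ~~ injectiveb f]| * n <=
  #|V| * (#|V| * (2 * n ^ (#|V| - 2))).
Proof.
move=> a2 s2.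
have [c _] : exists c, c \in s by apply/card_gt0P; rewrite s2.
pose B x x' := [set f : {ffun V -> 'I_n} |
   [&& f @: a == s, x \notin a, x' != x & f x == f x']].
have BE x x' : #|B x x'| * n <= 2 * n ^ (#|V| - 2).
  have [xa|xa] := boolP (x \in a); last first.
    rewrite -(card_imset_eq_at c a2 s2 xa) leq_mul2r; apply/orP; right.
    have [->|xx'] := eqVneq x' x.
      by rewrite eq_card0 // => f; rewrite !inE eqxx !andbF.
    (* Overwriting the value at [x] with [c] loses nothing: it can be read off at [x']. It also
       leaves the image of [a] unchanged, so [F] injects into maps with a prescribed value. *)
    pose F (f : {ffun V -> 'I_n}) : {ffun V -> 'I_n} :=
      [ffun z => if z == x then c else f z].
    rewrite -(@card_in_imset _ _ F).
      apply: subset_leq_card; apply/fintype.subsetP => g /imsetP[f].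
      rewrite inE => /and4P[fa _ _ _] ->; rewrite inE ffunE eqxx eqxx andbT.
      rewrite -(eqP fa); apply/eqP; apply: eq_in_imset => z za.
      by rewrite ffunE; case: eqP => // zx; rewrite -zx za in xa.
    move=> f g; rewrite !inE => /and4P[_ _ _ /eqP fx] /and4P[_ _ _ /eqP gx] FG.
    have E z : z != x -> f z = g z.
      by move=> zx; move/ffunP/(_ z): FG; rewrite !ffunE (negbTE zx).
    apply/ffunP => z; have [->|/E //] := eqVneq z x.
    by rewrite fx gx E.
  by rewrite eq_card0 // => f; rewrite !inE xa andbF.
apply: (@leq_trans (\sum_(x : V) \sum_(x' : V) #|B x x'| * n)); last first.
  rewrite -[X in _ <= X]sum_nat_const; apply: leq_sum => x _.
  rewrite -[X in _ <= X]sum_nat_const; apply: leq_sum => x' _; exact: BE.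
under eq_bigr do rewrite -big_distrl.
rewrite -big_distrl leq_mul2r; apply/orP; right => /=.
apply: (@leq_trans #|\bigcup_x \bigcup_x' B x x'|).
  apply: subset_leq_card; apply/fintype.subsetP => f; rewrite inE => /andP[fa ninj].
  suff [x [x' xx']] : exists x x', f \in B x x'.
    by apply/bigcupP; exists x => //; apply/bigcupP; exists x'.
  have /injectivePn[x [x' xx' fxx']] := ninj.
  have [xa|xa] := boolP (x \in a); last first.
    by exists x, x'; rewrite inE fa xa eq_sym xx' fxx' /=.
  have [xa'|xa'] := boolP (x' \in a); last first.
    by exists x', x; rewrite inE fa xa' xx' fxx' /=.
  have /imset_injP finj : #|f @: a| == #|a| by rewrite (eqP fa) s2 a2.
  by move/finj: fxx' => /(_ xa xa') xx; rewrite xx eqxx in xx'.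
have le_bigcup (F : V -> {set {ffun V -> 'I_n}}) : #|\bigcup_x F x| <= \sum_x #|F x|.
  elim/big_rec2: _ => [|x m S _ IH]; first by rewrite cards0.
  by rewrite (leq_trans (leq_card_setU _ _)) // leq_add2l.
by apply: (leq_trans (le_bigcup _)); apply: leq_sum => x _; exact: le_bigcup.
Qed.

End Counting.

Section Pairs.
Variable n : nat.
Implicit Types (q s t : opair n) (y : config n) (A : {set 'I_n}).

Definition pair_set q : {set 'I_n} := [set (val q).1; (val q).2]%SET.

Lemma pair_set_card q : #|pair_set q| = 2%N.
Proof. by case: q => [[i j] /= ij]; rewrite cards2 neq_ltn ij. Qed.

Lemma pair_set_inj : injective pair_set.
Proof.
move=> [[i j] /= ij] [[k l] /= kl] /eqP; rewrite /pair_set /=.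
have nkl : k != l by rewrite neq_ltn kl.
rewrite eq_set2 // => /orP[]/andP[/eqP Ei /eqP Ej]; apply: val_inj => /=.
  by rewrite Ei Ej.
by move: ij kl; rewrite Ei Ej => lk kl; have := ltn_trans lk kl; rewrite ltnn.
Qed.

(* [s] is a default value, returned only when [A] is not a pair. *)
Definition pair_of s A : opair n := odflt s [pick q | pair_set q == A].

Lemma pair_ofK s A : #|A| = 2%N -> pair_set (pair_of s A) = A.
Proof.
move=> A2; rewrite /pair_of; case: pickP => [q /eqP //|noq].
have /cards2P[i [j [nij EA]]] : #|A| == 2%N by rewrite A2.
have [ij|ji|/ord_inj ij] := ltngtP i j; last by rewrite ij eqxx in nij.
  have := noq (Sub (i, j) ij); by rewrite /pair_set SubK EA eqxx.
have := noq (Sub (j, i) ji); by rewrite /pair_set SubK EA finset.setUC eqxx.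
Qed.

Lemma mem_config_edges y q : (pair_set q \in config_edges y) = y q.
Proof.
apply/imsetP/idP => [[q']|yq]; last by exists q; rewrite ?inE.
by rewrite inE => yq' /pair_set_inj ->.
Qed.

Lemma mem_config_edges_pair s y A : #|A| = 2%N ->
  (A \in config_edges y) = y (pair_of s A).
Proof. by move=> A2; rewrite -mem_config_edges pair_ofK. Qed.

Lemma mem_config_edges_flip s y A : y s = false -> #|A| = 2%N ->
  (A \in config_edges (flip s y)) = (A == pair_set s) || (A \in config_edges y).
Proof.
move=> ys A2; rewrite -(pair_ofK s A2) !mem_config_edges ffunE.
rewrite (inj_eq pair_set_inj).
by case: eqP => [->|]; rewrite ?ys.
Qed.

End Pairs.

Section Placements.
Variables (H : sgraph) (n : nat).
Implicit Types (s t : opair n) (y : config n).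
Local Notation V := (vertices H).
Local Notation place := ({ffun V -> 'I_n} * {set V})%type.
Implicit Type i : place.

(* A placement [(f, a)] of [H] at [s] is an embedding [f] together with the edge
   [a] that it sends onto [s]. *)
Definition placed s i : bool :=
  [&& injectiveb i.1, i.2 \in edges H & i.1 @: i.2 == pair_set s].

Definition other_pairs s i : seq (opair n) :=
  [seq pair_of s (i.1 @: b) | b : {set V} <- enum (edges H :\ i.2)%SET].

Lemma placed_card s i (b : {set V}) : placed s i -> b \in edges H ->
  #|i.1 @: b| = 2%N.
Proof.
move=> /and3P[/injectiveP inj _ _] bH; rewrite card_imset //.
exact: edges_card2.
Qed.

Lemma size_other_pairs s i : placed s i -> size (other_pairs s i) = (ne H - 1)%N.
Proof.
move=> /and3P[_ aH _]; rewrite size_map -cardE subn1.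
by rewrite /ne (cardsD1 i.2 (edges H)) aH.
Qed.

Lemma uniq_other_pairs s i : placed s i -> uniq (other_pairs s i).
Proof.
move=> Di; rewrite map_inj_in_uniq ?enum_uniq // => b c.
rewrite !mem_enum !inE => /andP[_ bH] /andP[_ cH] E.
have /and3P[/injectiveP inj _ _] := Di.
apply: (imset_inj inj).
by rewrite -(pair_ofK s (placed_card Di bH)) -(pair_ofK s (placed_card Di cH)) E.
Qed.

(** An injective map determines the edge it sends onto [s], so counting maps and counting placements
    agree. The count thus becomes a polynomial in the edge indicators, the form needed for the noise
    estimates. *)
Lemma nhom_at_placed s y (R : comPzSemiRingType) :
  (nhom_at H (graph_of y) (pair_set s))%:R =
  \sum_(i | placed s i) \prod_(u <- other_pairs s i) (y u)%:R :> R.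
Proof.
rewrite /nhom_at -sum1_card natr_sum.
rewrite (eq_bigl (fun i => placed s (i.1, i.2))); last by case.
rewrite -(pair_big_dep xpredT (fun f a => placed s (f, a))
  (fun f a => \prod_(u <- other_pairs s (f, a)) ((y u)%:R : R))) /=.
rewrite big_mkcond; apply: eq_bigr => f _ /=.
rewrite inE; have [inj|ninj] := boolP (injectiveb f); last first.
  by rewrite big1 // => a /and3P[/= h]; rewrite h in ninj.
have prodE a : placed s (f, a) -> \prod_(u <- other_pairs s (f, a)) (y u)%:R =
   ([forall b in edges H, (b != a) ==> (f @: b \in config_edges y)])%:R :> R.
  move=> Da; rewrite big_map big_enum /=.
  case: (boolP [forall b in edges H, _]) => [/forall_inP h|/forall_inPn[b bH]].
    rewrite big1 // => b; rewrite !inE => /andP[ba bH].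
    have := h b bH; rewrite ba /= (mem_config_edges_pair s); first by move=> ->.
    exact: (placed_card Da).
  rewrite negb_imply => /andP[ba fb].
  rewrite (bigD1 b) /=; last by rewrite !inE ba bH.
  rewrite (mem_config_edges_pair s) in fb; last exact: (placed_card Da).
  by rewrite (negbTE fb) mul0r.
have placedE a : placed s (f, a) = (a \in edges H) && (f @: a == pair_set s).
  by rewrite /placed /= inj.
rewrite (eq_bigr _ prodE) /=.
case: ifPn => [/exists_inP[a aH /andP[fa fb]]|/exists_inPn h].
  rewrite (big_pred1 a) ?fb // => b; rewrite placedE.
  apply/andP/eqP => [[bH /eqP fb']|-> //].
  by apply: (imset_inj (injectiveP _ inj)); rewrite fb' (eqP fa).
rewrite big1 // => a; rewrite placedE => /andP[aH fa].
by have := h a aH; rewrite fa /= => /negbTE ->.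
Qed.

(** The embeddings gained by adding the edge s are precisely those that use it. This makes the
    conditional log-odds of an edge a combination of the counts at s. *)
Lemma nhom_flip s y : y s = false ->
  nhom H (graph_of (flip s y)) =
  (nhom H (graph_of y) + nhom_at H (graph_of y) (pair_set s))%N.
Proof.
move=> ys; rewrite /nhom /nhom_at -cardsUI.
rewrite [X in (_ + X)%N](_ : _ = 0%N) ?addn0; last first.
  apply/eqP; rewrite cards_eq0; apply/eqP/setP => f; rewrite !inE.
  apply/negP => /andP[/andP[_ /forall_inP h] /andP[_ /exists_inP[a aH /andP[/eqP fa _]]]].
  have := h a aH; by rewrite fa mem_config_edges ys.
apply: eq_card => f; rewrite !inE -andb_orr; apply: andb_id2l => /injectiveP inj.
have c2 a : a \in edges H -> #|f @: a| = 2%N.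
  by move=> aH; rewrite card_imset // edges_card2.
apply/forall_inP/orP => [h|[/forall_inP h a aH|]].
- have [h'|/forall_inPn[a aH fa]] := boolP [forall a in edges H, f @: a \in edges (graph_of y)].
    by left.
  right; apply/exists_inP; exists a => //.
  have := h a aH; rewrite (mem_config_edges_flip ys (c2 _ aH)).
  rewrite (negbTE fa) orbF => fas; rewrite fas /=.
  apply/forall_inP => b bH; apply/implyP => ba.
  have := h b bH; rewrite (mem_config_edges_flip ys (c2 _ bH)).
  by rewrite -(eqP fas) (inj_eq (imset_inj inj)) (negbTE ba).
- by rewrite (mem_config_edges_flip ys (c2 _ aH)) h ?orbT.
- move=> /exists_inP[a aH /andP[/eqP fa /forall_inP h]] b bH.
  rewrite (mem_config_edges_flip ys (c2 _ bH)).
  have [->|ba] := eqVneq b a; first by rewrite fa eqxx.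
  by have := h b bH; rewrite ba /= => ->; rewrite orbT.
Qed.

Lemma nhom_at_flip s y :
  nhom_at H (graph_of (flip s y)) (pair_set s) =
  nhom_at H (graph_of y) (pair_set s).
Proof.
rewrite /nhom_at; apply: eq_card => f; rewrite !inE.
apply: andb_id2l => /injectiveP inj; apply: eq_existsb => a.
apply: andb_id2l => aH; apply: andb_id2l => /eqP fa.
apply: eq_forallb => b; case: (boolP (b \in edges H)) => //= bH.
have [//|ba /=] := eqVneq b a.
have c2 : #|f @: b| = 2%N by rewrite card_imset // edges_card2.
rewrite !(mem_config_edges_pair s) // flip_other //.
apply: contra_neq ba => E; apply: (imset_inj inj).
by rewrite fa -[LHS](pair_ofK s c2) E.
Qed.

Lemma sum_placed (F : place -> nat) s :
  \sum_(i | placed s i) F i =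
  (\sum_(a in edges H)
    \sum_(f : {ffun V -> 'I_n} | injectiveb f && (f @: a == pair_set s))
      F (f, a))%N.
Proof.
rewrite (eq_bigl (fun i => placed s (i.1, i.2))); last by case.
rewrite (eq_bigr (fun i => F (i.1, i.2))); last by case.
rewrite -(pair_big_dep xpredT (fun f a => placed s (f, a)) (fun f a => F (f, a))) /=.
rewrite (exchange_big_dep (mem (edges H))) /=; last by move=> f a _ /and3P[].
apply: eq_bigr => a aH; apply: eq_bigl => f.
by rewrite /placed /= aH.
Qed.

Lemma card_placed_le s : (#|placed s| <= 2 * ne H * n ^ (nv H - 2))%N.
Proof.
rewrite -sum1_card (eq_bigl (placed s)) // sum_placed -mulnA mulnCA.
rewrite -[X in (_ <= X)%N]sum_nat_const; apply: leq_sum => a aH.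
have a2 := edges_card2 aH.
rewrite -(card_imset_eq a2 (pair_set_card s)) sum1_card.
by apply: subset_leq_card; apply/fintype.subsetP => f; rewrite !inE => /andP[].
Qed.

Lemma card_placed_ge s :
  (2 * ne H * n ^ (nv H - 2) * n <=
   (#|placed s| * n + ne H * (nv H * (nv H * (2 * n ^ (nv H - 2))))))%N.
Proof.
rewrite -[#|placed s|]sum1_card (eq_bigl (placed s)) // sum_placed.
rewrite -mulnA -mulnA mulnCA.
rewrite -[X in (X <= _)%N]sum_nat_const -[X in (_ <= _ + X)%N]sum_nat_const.
rewrite big_distrl -big_split; apply: leq_sum => a aH /=.
have a2 := edges_card2 aH.
have h := card_imset_noninj a2 (pair_set_card s).
rewrite mulnA -[X in (X * n <= _)%N](card_imset_eq a2 (pair_set_card s)).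
apply: leq_trans (leq_add (leqnn _) h).
rewrite -mulnDl leq_mul2r; apply/orP; right.
rewrite -!sum1_card (bigID (fun f : {ffun V -> 'I_n} => injectiveb f)) /=.
by apply: leq_add; rewrite leq_eqVlt; apply/orP; left; apply/eqP; apply: eq_bigl => f;
  rewrite !inE // andbC.
Qed.

(** If an edge other than [a] lands on [t], one of its vertices lies outside [a] and is confined to
    the two points of [t]; this extra constraint saves a factor n. The 4 is two orientations of [a]
    times two points of [t]. For [t = s] injectivity leaves no such placement. *)
Lemma card_placed_mem_le s t :
  (#|[pred i | placed s i && (t \in other_pairs s i)]| * n <=
   ne H * (nv H * (4 * n ^ (nv H - 2))))%N.
Proof.
have [->|ts] := eqVneq t s.
  rewrite eq_card0 // => i; rewrite !inE; apply/negP => /andP[Di].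
  move=> /mapP[b]; rewrite mem_enum !inE => /andP[ba bH] sE.
  have /and3P[/injectiveP inj _ /eqP ai] := Di.
  move/negP: ba; apply; apply/eqP; apply: (imset_inj inj).
  by rewrite ai -(pair_ofK s (placed_card Di bH)) -sE.
rewrite -sum1_card.
rewrite (eq_bigl (fun i => placed s i && (t \in other_pairs s i))) //.
rewrite big_mkcondr sum_placed.
rewrite big_distrl -sum_nat_const; apply: leq_sum => a aH.
have a2 := edges_card2 aH.
apply: (@leq_trans (\sum_(x | x \notin a)
   #|[pred f : {ffun V -> 'I_n} | (f @: a == pair_set s) && (f x \in pair_set t)]| * n)).
  rewrite -big_distrl leq_mul2r; apply/orP; right.
  under [X in (_ <= X)%N]eq_bigr do rewrite -sum1_card.
  rewrite (exchange_big_dep (fun f : {ffun V -> 'I_n} => f @: a == pair_set s)) /=; last first.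
    by move=> x f _ /andP[].
  rewrite -big_mkcondr.
  rewrite [X in (_ <= X)%N](bigID (fun f : {ffun V -> 'I_n} =>
    injectiveb f && (t \in other_pairs s (f, a)))) /=.
  apply: leq_trans (leq_addr _ _).
  rewrite [X in (X <= _)%N](eq_bigl (fun f : {ffun V -> 'I_n} => (f @: a == pair_set s) &&
     (injectiveb f && (t \in other_pairs s (f, a))))); last first.
    by move=> f; rewrite andbA; congr (_ && _); rewrite andbC.
  apply: leq_sum => f /and3P[fa /[dup] injb /injectiveP inj /mapP[b]].
  rewrite mem_enum !inE /= => /andP[ba bH] tE.
  have Di : placed s (f, a) by rewrite /placed /= injb aH fa.
  have fb : f @: b = pair_set t by rewrite tE (pair_ofK _ (placed_card Di bH)).
  have /subsetPn[x xb xa] : ~~ (b \subset a).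
    apply: contra ba => ba; rewrite eqEcard ba a2.
    by rewrite (edges_card2 bH).
  have xt : f x \in pair_set t by rewrite -fb imset_f.
  rewrite (bigD1 x) //=; apply/andP; split; first exact: xa.
  by apply/andP; split; [exact: fa|exact: xt].
rewrite -[nv H]/(#|V|).
apply: (@leq_trans (\sum_(x | x \notin a) 4 * n ^ (nv H - 2))).
  apply: leq_sum => x xa.
  by rewrite card_imset_eq_mem ?pair_set_card.
by rewrite sum_nat_const leq_mul2r max_card orbT.
Qed.

End Placements.

(** * Weighted counts *)

Section Inequalities.
Variable R : realType.

Lemma finite_max (I : finType) (f : I -> R) (i0 : I) :
  exists i, forall j, f j <= f i.
Proof.
exists [arg max_(i > i0) f i]%O => j.
by case: arg_maxP => //= i _; apply.
Qed.

Lemma sum_expr_le (I : finType) (x : I -> R) m : (forall i, 0 <= x i) ->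
  (\sum_i x i) ^+ m.+1 <= #|I|%:R ^+ m.+1 * \sum_i x i ^+ m.+1.
Proof.
move=> x0; have [i0 _|noI] := pickP (fun _ : I => true); last first.
  by rewrite big_pred0 // expr0n /= mulr_ge0 ?exprn_ge0 // sumr_ge0 // => i _;
    rewrite exprn_ge0.
have [j xj] := finite_max x i0.
apply: (@le_trans _ _ ((#|I|%:R * x j) ^+ m.+1)).
  apply: lerXn2r; rewrite ?nnegrE ?sumr_ge0 ?mulr_ge0 //.
  by rewrite mulr_natl -sumr_const; apply: ler_sum.
rewrite exprMn ler_wpM2l ?exprn_ge0 // (bigD1 j) //= lerDl sumr_ge0 // => i _.
by rewrite exprn_ge0.
Qed.

(** Convexity of the cube, with the additive term [b] treated as a point [b / gamma] of weight
    [gamma]. The inequality sums tangent lines at [z], the mean for total weight [t + gamma];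
    weights summing to less than [t] only help. *)
Lemma jensen_cube (I : finType) (w x : I -> R) (t gamma b : R) :
  (forall i, 0 <= w i) -> (forall i, 0 <= x i) -> 0 <= t -> 0 < gamma ->
  0 <= b -> \sum_i w i <= t ->
  (\sum_i w i * x i + b) ^+ 3 <=
  (t + gamma) ^+ 2 * (\sum_i w i * x i ^+ 3 + b ^+ 3 / gamma ^+ 2).
Proof.
move=> w0 x0 t0 g0 b0 wt.
set L := \sum_i w i * x i.
have L0 : 0 <= L by apply: sumr_ge0 => i _; rewrite mulr_ge0.
set S := t + gamma; have S0 : 0 < S by rewrite /S; lra.
pose z := (L + b) / S.
have z0 : 0 <= z by rewrite divr_ge0 ?addr_ge0 // ltW.
have tangent x' : 0 <= x' -> 3 * z ^+ 2 * x' - 2 * z ^+ 3 <= x' ^+ 3.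
  move=> x'0; rewrite -subr_ge0.
  have -> : x' ^+ 3 - (3 * z ^+ 2 * x' - 2 * z ^+ 3) =
    (x' - z) ^+ 2 * (x' + 2 * z) by ring.
  by rewrite mulr_ge0 ?sqr_ge0 // addr_ge0 // mulr_ge0.
have h1 : 3 * z ^+ 2 * L - 2 * z ^+ 3 * t <= \sum_i w i * x i ^+ 3.
  apply: (@le_trans _ _ (3 * z ^+ 2 * L - 2 * z ^+ 3 * \sum_i w i)).
    by rewrite lerD2l lerN2 ler_wpM2l // mulr_ge0 // exprn_ge0.
  rewrite /L !mulr_sumr -sumrB; apply: ler_sum => i _.
  have := ler_wpM2l (w0 i) (tangent _ (x0 i)).
  by apply: le_trans; rewrite le_eqVlt; apply/orP; left; apply/eqP; ring.
have h2 : 3 * z ^+ 2 * b - 2 * z ^+ 3 * gamma <= b ^+ 3 / gamma ^+ 2.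
  have := ler_wpM2l (ltW g0) (tangent (b / gamma) (divr_ge0 b0 (ltW g0))).
  have -> : gamma * (b / gamma) ^+ 3 = b ^+ 3 / gamma ^+ 2.
    by field; rewrite gt_eqF.
  by apply: le_trans; rewrite le_eqVlt; apply/orP; left; apply/eqP; field; rewrite gt_eqF.
have -> : (L + b) ^+ 3 = S ^+ 2 * ((3 * z ^+ 2 * L - 2 * z ^+ 3 * t) +
    (3 * z ^+ 2 * b - 2 * z ^+ 3 * gamma)).
  have -> : (3 * z ^+ 2 * L - 2 * z ^+ 3 * t) +
    (3 * z ^+ 2 * b - 2 * z ^+ 3 * gamma) =
    3 * z ^+ 2 * (L + b) - 2 * z ^+ 3 * S by rewrite /S; ring.
  by rewrite /z; field; rewrite gt_eqF.
by rewrite ler_wpM2l ?sqr_ge0 // lerD.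
Qed.

End Inequalities.

Section Model.
Variables (R : realType) (n : nat).

Definition scale (H : sgraph) : R := (n%:R ^+ (nv H - 2))^-1.

(** A crude constant that dominates both the loss from non-injective maps and the placements through
    a given second pair. *)
Definition count_cst (H : sgraph) : nat := (4 * ne H * (nv H).+1 ^ 2 + 2 * ne H)%N.

Lemma scale_ge0 H : 0 <= scale H.
Proof. by rewrite invr_ge0 exprn_ge0. Qed.

Implicit Types (s t u : opair n) (y : config n).

Lemma opair_gt0 s : (0 < n)%N.
Proof. by case: s => [[i j] _]; apply: leq_ltn_trans (ltn_ord i). Qed.

Lemma scaleM_natr H s (a b : nat) : (a <= b * n ^ (nv H - 2))%N ->
  scale H * a%:R <= b%:R.
Proof.
move=> ab; have n0 : 0 < n%:R :> R by rewrite ltr0n (opair_gt0 s).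
rewrite /scale mulrC ler_pdivrMr ?exprn_gt0 // -natrX -natrM ler_nat //.
Qed.

Lemma scale_card_placed_le H s : scale H * #|@placed H n s|%:R <= (2 * ne H)%:R.
Proof. by apply: (scaleM_natr s); exact: card_placed_le. Qed.

Lemma scale_card_placed H s :
  `|scale H * #|@placed H n s|%:R - (2 * ne H)%:R| <= (count_cst H)%:R / n%:R.
Proof.
have n0 : 0 < n%:R :> R by rewrite ltr0n (opair_gt0 s).
rewrite ler_norml; apply/andP; split; last first.
  apply: (@le_trans _ _ 0); first by rewrite subr_le0 scale_card_placed_le.
  by rewrite divr_ge0 // ltW.
suff : (2 * ne H)%:R <= scale H * #|@placed H n s|%:R + (count_cst H)%:R / n%:R by lra.
rewrite -(ler_pM2r n0) mulrDl divfK ?gt_eqF //.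
have sc : scale H * (n ^ (nv H - 2))%:R = 1.
  by rewrite natrX mulVf // gt_eqF // exprn_gt0.
have := @card_placed_ge H n s; rewrite -(ler_nat R) => /(ler_wpM2l (scale_ge0 H)).
set cc := (count_cst H)%:R; rewrite !(natrD, natrM).
have -> : scale H * (2 * (ne H)%:R * (n ^ (nv H - 2))%:R * n%:R) =
  (scale H * (n ^ (nv H - 2))%:R) * (2 * (ne H)%:R * n%:R) by ring.
have -> : scale H * (#|@placed H n s|%:R * n%:R +
   (ne H)%:R * ((nv H)%:R * ((nv H)%:R * (2 * (n ^ (nv H - 2))%:R)))) =
  scale H * #|@placed H n s|%:R * n%:R +
  (scale H * (n ^ (nv H - 2))%:R) * (2 * (ne H)%:R * (nv H)%:R ^+ 2) by ring.
rewrite sc !mul1r => /le_trans; apply; rewrite lerD2l.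
have -> : 2 * (ne H)%:R * (nv H)%:R ^+ 2 = (2 * ne H * nv H ^ 2)%:R :> R.
  by rewrite !natrM; ring.
rewrite ler_nat /count_cst; nia.
Qed.

Lemma scale_card_placed_mem H s t :
  scale H * #|[pred i | placed s i && (t \in @other_pairs H n s i)]|%:R <=
  (count_cst H)%:R / n%:R.
Proof.
have n0 : 0 < n%:R :> R by rewrite ltr0n (opair_gt0 s).
rewrite ler_pdivlMr // -mulrA -natrM; apply: (scaleM_natr s).
apply: leq_trans (card_placed_mem_le H s t) _.
rewrite /count_cst !mulnA leq_mul2r; apply/orP; right; nia.
Qed.

(* [sub_density] estimates [2 * ne H] times a product of [ne H - 1] edge
   densities when its argument is a field of edge densities. *)
Definition sub_density (H : sgraph) (f : opair n -> R) s : R :=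
  scale H * \sum_(i | @placed H n s i) \prod_(u <- other_pairs s i) f u.

Definition spread_kernel (H : sgraph) s t : R :=
  scale H * \sum_(i | @placed H n s i) (t \in other_pairs s i)%:R.

Lemma spread_kernel_ge0 H s t : 0 <= spread_kernel H s t.
Proof. by rewrite mulr_ge0 ?scale_ge0 // sumr_ge0. Qed.

Lemma spread_kernelE H s (g : opair n -> R) :
  scale H * \sum_(i | @placed H n s i) \sum_(u <- other_pairs s i) g u =
  \sum_t spread_kernel H s t * g t.
Proof.
under [RHS]eq_bigr do rewrite -mulrA mulr_suml.
rewrite -mulr_sumr exchange_big; congr (_ * _); apply: eq_bigr => i Di /=.
rewrite big_uniq ?uniq_other_pairs // big_mkcond.
by apply: eq_bigr => u _; case: (u \in _); rewrite ?mul1r ?mul0r.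
Qed.

(** Every placement has e - 1 other edges. The total 2e(e-1) is the slope of 2e a^{e-1} at a = 1,
    which is why these row sums reproduce [2 * dPhi] once weighted by powers of the density. *)
Lemma sum_spread_kernel H s :
  \sum_t spread_kernel H s t <= (2 * ne H)%:R * (ne H - 1)%:R.
Proof.
under eq_bigr do rewrite -[spread_kernel _ _ _]mulr1.
rewrite -spread_kernelE (eq_bigr (fun=> (ne H - 1)%:R)); last first.
  by move=> i Di; rewrite big_const_seq count_predT iter_addr_0 size_other_pairs.
have -> : \sum_(i | @placed H n s i) (ne H - 1)%:R =
    #|@placed H n s|%:R * (ne H - 1)%:R :> R.
  by rewrite mulr_natl -sumr_const; apply: eq_bigl => i.
by rewrite mulrA ler_wpM2r // scale_card_placed_le.
Qed.

Lemma sub_density_near H (f : opair n -> R) s (p b : R) :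
  (forall u, 0 <= f u <= b) -> 0 <= p <= b -> p <= 1 ->
  `|sub_density H f s - (2 * ne H)%:R * p ^+ (ne H - 1)| <=
  b ^+ (ne H - 1).-1 * (\sum_t spread_kernel H s t * `|f t - p|) +
  (count_cst H)%:R / n%:R.
Proof.
move=> fb pb p1; have /andP[p0 _] := pb.
have E : sub_density H f s - (2 * ne H)%:R * p ^+ (ne H - 1) =
  scale H * \sum_(i | @placed H n s i)
    (\prod_(u <- other_pairs s i) f u - p ^+ (ne H - 1)) +
  (scale H * #|@placed H n s|%:R - (2 * ne H)%:R) * p ^+ (ne H - 1).
  rewrite sumrB /sub_density.
  have -> : \sum_(i | @placed H n s i) p ^+ (ne H - 1) =
    #|@placed H n s|%:R * p ^+ (ne H - 1).
    by rewrite mulr_natl -sumr_const; apply: eq_bigl => i.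
  by rewrite mulrBr mulrBl mulrA addrA subrK.
rewrite {}E (le_trans (ler_normD _ _)) //; apply: lerD; last first.
  rewrite normrM -[leRHS]mulr1; apply: ler_pM => //; first exact: scale_card_placed.
  by rewrite ger0_norm ?exprn_ge0 // exprn_ile1.
rewrite normrM ger0_norm ?scale_ge0 // -spread_kernelE mulrCA.
rewrite ler_wpM2l ?scale_ge0 // (le_trans (ler_norm_sum _ _ _)) // mulr_sumr.
apply: ler_sum => i Di.
have := distr_prod_le (other_pairs s i) fb (fun _ => pb).
rewrite big_const_seq count_predT size_other_pairs //.
by rewrite -(size_other_pairs Di) iter_mulr_1 size_other_pairs.
Qed.

Lemma sub_density_mono H (f : opair n -> R) s a :
  (forall u, 0 <= f u <= a) ->
  sub_density H f s <= scale H * #|@placed H n s|%:R * a ^+ (ne H - 1).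
Proof.
move=> fa; rewrite -mulrA ler_wpM2l ?scale_ge0 //.
have -> : #|@placed H n s|%:R * a ^+ (ne H - 1) =
    \sum_(i | @placed H n s i) a ^+ (ne H - 1).
  by rewrite mulr_natl -sumr_const; apply: eq_bigl => i.
apply: ler_sum => i Di; rewrite -(size_other_pairs Di).
elim: (other_pairs s i) => [|u r IH]; first by rewrite big_nil.
have /andP[f0 fu] := fa u.
rewrite big_cons exprS ler_pM // prodr_ge0 // => v _; by case/andP: (fa v).
Qed.

Lemma sub_density_mono_ge H (f : opair n -> R) s a : 0 <= a ->
  (forall u, a <= f u) ->
  scale H * #|@placed H n s|%:R * a ^+ (ne H - 1) <= sub_density H f s.
Proof.
move=> a0 fa; rewrite -mulrA ler_wpM2l ?scale_ge0 //.
have -> : #|@placed H n s|%:R * a ^+ (ne H - 1) =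
    \sum_(i | @placed H n s i) a ^+ (ne H - 1).
  by rewrite mulr_natl -sumr_const; apply: eq_bigl => i.
apply: ler_sum => i Di; rewrite -(size_other_pairs Di).
elim: (other_pairs s i) => [|u r IH]; first by rewrite big_nil.
by rewrite big_cons exprS ler_pM // exprn_ge0.
Qed.

End Model.

(** * The conditional edge probabilities *)

Section Gibbs.
Variables (R : realType) (k : nat) (Hs : 'I_k -> sgraph) (beta : 'I_k -> R).
Variable n : nat.
Implicit Types (s t u : opair n) (y : config n).

Definition local_field s y : R := \sum_(j < k)
  beta j * (scale R n (Hs j) *
            (nhom_at (Hs j) (graph_of y) (pair_set s))%:R).

(* The probability that [y s] holds given the other coordinates of [y], by
   [ergm_balance] below. *)
Definition cond_prob s y : R := sigm (local_field s y).

Local Notation pmf := (@ergm_pmf R k Hs beta n).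

Lemma local_field_flip s y : local_field s (flip s y) = local_field s y.
Proof. by apply: eq_bigr => j _; rewrite nhom_at_flip. Qed.

Lemma ergm_weight_flip s y : y s = false ->
  ergm_weight Hs beta (flip s y) =
  ergm_weight Hs beta y * expR (local_field s y).
Proof.
move=> ys; rewrite /ergm_weight -expRD -big_split; congr expR.
by apply: eq_bigr => j _; rewrite /= nhom_flip // natrD mulrDr mulrA.
Qed.

Lemma ergm_Z_gt0 : 0 < ergm_Z Hs beta n.
Proof.
rewrite /ergm_Z (bigD1 [ffun=> false]) //= ltr_wpDr ?expR_gt0 //.
by apply: sumr_ge0 => y _; rewrite expR_ge0.
Qed.

Lemma ergm_pmf_ge0 y : 0 <= pmf y.
Proof. by rewrite divr_ge0 ?expR_ge0 // ltW ?ergm_Z_gt0. Qed.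

Lemma ergm_pmf_sum1 : \sum_(y : config n) pmf y = 1.
Proof. by rewrite -mulr_suml divff // gt_eqF // ergm_Z_gt0. Qed.

Lemma cond_prob01 s y : 0 <= cond_prob s y <= 1.
Proof. by rewrite ltW ?sigm_gt0 //= ltW ?sigm_lt1. Qed.

Lemma cond_prob_flip s y : cond_prob s (flip s y) = cond_prob s y.
Proof. by rewrite /cond_prob local_field_flip. Qed.

Lemma ergm_balance s y :
  pmf y * ((y s)%:R - cond_prob s y) +
  pmf (flip s y) * ((flip s y s)%:R - cond_prob s y) = 0.
Proof.
wlog ys : y / y s = false.
  move=> wl; have [E|] : y s = true \/ y s = false; last exact: wl.
      by case: (y s); [left|right].
    have := wl (flip s y); rewrite !flip_same E flipK cond_prob_flip => /(_ erefl).
    by rewrite addrC.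
rewrite flip_same ys /ergm_pmf ergm_weight_flip // /cond_prob /sigm /=.
have nz : expR (local_field s y) + 1 != 0.
  by rewrite gt_eqF // addr_gt0 // expR_gt0.
have nZ : ergm_Z Hs beta n != 0 by rewrite gt_eqF // ergm_Z_gt0.
by field; rewrite nz nZ.
Qed.

Lemma scale_nhom_at H s y :
  scale R n H * (nhom_at H (graph_of y) (pair_set s))%:R =
  sub_density H (fun u => (y u)%:R) s.
Proof. by rewrite /sub_density nhom_at_placed. Qed.

Lemma scale_nhom_at_flip H s t y :
  `|scale R n H * (nhom_at H (graph_of y) (pair_set s))%:R -
    scale R n H * (nhom_at H (graph_of (flip t y)) (pair_set s))%:R| <=
  (count_cst H)%:R / n%:R.
Proof.
apply: le_trans (scale_card_placed_mem R H s t).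
rewrite !scale_nhom_at /sub_density -mulrBr normrM ger0_norm ?scale_ge0 //.
rewrite ler_wpM2l ?scale_ge0 // -sumrB (le_trans (ler_norm_sum _ _ _)) //.
have -> : #|[pred i | placed s i && (t \in @other_pairs H n s i)]|%:R =
    \sum_(i | placed s i) (t \in @other_pairs H n s i)%:R :> R.
  by rewrite -sum1_card natr_sum big_mkcondr /=; apply: eq_bigr => i _; case: (t \in _).
apply: ler_sum => i Di; case: (boolP (t \in _)) => ti /=.
  have b01 (z : config n) : 0 <= \prod_(u <- other_pairs s i) ((z u)%:R : R) <= 1.
    by apply: prodr_unit_itv => u; case: (z u); rewrite lexx ler01.
  have /andP[a0 a1] := b01 y; have /andP[c0 c1] := b01 (flip t y).
  by rewrite ler_norml; lra.
rewrite (_ : \prod_(u <- _) (y u)%:R = \prod_(u <- other_pairs s i) (flip t y u)%:R).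
  by rewrite subrr normr0.
rewrite !big_seq; apply: eq_bigr => u us; rewrite flip_other //.
by apply: contraNneq ti => <-.
Qed.

Definition model_cst : R := \sum_(j < k) `|beta j| * (count_cst (Hs j))%:R.

Lemma model_cst_ge0 : 0 <= model_cst.
Proof. by apply: sumr_ge0 => j _; rewrite mulr_ge0. Qed.

Lemma cond_prob_lip t u y :
  `|cond_prob u y - cond_prob u (flip t y)| <= model_cst / n%:R.
Proof.
apply: (le_trans (sigm_lip _ _)).
rewrite /local_field -sumrB (le_trans (ler_norm_sum _ _ _)) //.
rewrite /model_cst mulr_suml; apply: ler_sum => j _.
by rewrite -mulrBr normrM -mulrA ler_wpM2l // scale_nhom_at_flip.
Qed.

Definition graph_noise (H : sgraph) s y : R :=
  noise cond_prob (@placed H n s) (other_pairs s) (scale R n H) y.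

Lemma scale_nhom_at_noise H s y :
  scale R n H * (nhom_at H (graph_of y) (pair_set s))%:R =
  sub_density H (cond_prob^~ y) s + graph_noise H s y.
Proof.
by rewrite scale_nhom_at /sub_density /graph_noise /noise -mulrDr sumrB addrC subrK.
Qed.

(* Deviation of the local field from its mean-field value that is not
   accounted for by the deviations of the conditional probabilities. *)
Definition field_error s y : R := \sum_(j < k)
  `|beta j| * ((count_cst (Hs j))%:R / n%:R + `|graph_noise (Hs j) s y|).

Lemma field_error_ge0 s y : 0 <= field_error s y.
Proof.
by apply: sumr_ge0 => j _; rewrite mulr_ge0 // addr_ge0 // divr_ge0.
Qed.

Lemma ergm_expect (X : config n -> R) : ergm_E Hs beta X = expect pmf X.
Proof. by []. Qed.

End Gibbs.

Section NoiseMoments.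
Variables (R : realType) (k : nat) (Hs : 'I_k -> sgraph) (beta : 'I_k -> R).

Lemma graph_noise_moment (H : sgraph) m : exists2 C : R, 0 <= C &
  forall n (s : opair n),
    ergm_E Hs beta (fun y : config n => graph_noise Hs beta H s y ^+ m.*2)
      <= C / n%:R ^+ m.
Proof.
(* The three summands serve, in order, the total weight of the placements, the weight through one
   pair and the influence of one edge on the conditional probabilities. *)
pose A := (2 * ne H + count_cst H)%:R + model_cst Hs beta.
have K0 := model_cst_ge0 Hs beta.
have A0 : 0 <= A by rewrite addr_ge0.
have [C C0 hC] := @noise_moment R (ne H) A m A0.
exists C => // n s.
have n1 : 1 <= n%:R :> R by rewrite ler1n (opair_gt0 s).
have n0 : 0 < n%:R :> R by lra.
rewrite -exprVn.
apply: (hC _ _ _ (model_cst Hs beta / n%:R)).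
- exact: ergm_pmf_ge0.
- exact: ergm_pmf_sum1.
- exact: cond_prob01.
- exact: cond_prob_flip.
- exact: ergm_balance.
- by move=> *; exact: cond_prob_lip.
- exact: uniq_other_pairs.
- by move=> i Di; rewrite size_other_pairs // leq_subr.
- exact: scale_ge0.
- by rewrite invr_ge0 ltW //= invf_le1.
- apply: (le_trans (scale_card_placed_le R H s)).
  by rewrite /A natrD -addrA lerDl addr_ge0.
- move=> t; apply: (le_trans (scale_card_placed_mem R H s t)).
  rewrite ler_wpM2r ?invr_ge0 ?(ltW n0) // /A natrD addrAC lerDr.
  by rewrite addr_ge0.
- by rewrite ler_wpM2r ?invr_ge0 ?(ltW n0) // lerDr.
Qed.

Lemma field_error_moment m : exists2 C : R, 0 <= C &
  forall n (s : opair n),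
    ergm_E Hs beta (fun y : config n => field_error Hs beta s y ^+ m.+1.*2)
      <= C / n%:R ^+ m.+1.
Proof.
have /choice[C hC] : forall j : 'I_k, exists C : R, 0 <= C /\ forall n (s : opair n),
    ergm_E Hs beta (fun y : config n => graph_noise Hs beta (Hs j) s y ^+ m.+1.*2)
      <= C / n%:R ^+ m.+1.
  by move=> j; have [C C0 h] := graph_noise_moment (Hs j) m.+1; exists C.
pose q := m.+1.*2.
pose D j := `|beta j| ^+ q * (2 ^+ q * ((count_cst (Hs j))%:R ^+ q + C j)).
have D0 j : 0 <= D j.
  have [Cj0 _] := hC j.
  by rewrite mulr_ge0 ?exprn_ge0 // mulr_ge0 ?addr_ge0 ?exprn_ge0.
exists (k%:R ^+ q * \sum_j D j).
  by rewrite mulr_ge0 ?exprn_ge0 // sumr_ge0.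
move=> n s.
have n1 : 1 <= n%:R :> R by rewrite ler1n (opair_gt0 s).
have n0 : 0 < n%:R :> R by lra.
rewrite ergm_expect.
apply: (@le_trans _ _ (expect (@ergm_pmf R k Hs beta n) (fun y : config n =>
   k%:R ^+ q * \sum_j `|beta j| ^+ q * (2 ^+ q *
     ((count_cst (Hs j))%:R ^+ q / n%:R ^+ m.+1 + graph_noise Hs beta (Hs j) s y ^+ q))))).
  apply: (le_expect (@ergm_pmf_ge0 _ _ _ _ _)) => y.
  have := @sum_expr_le R 'I_k (fun j => `|beta j| * ((count_cst (Hs j))%:R / n%:R
    + `|graph_noise Hs beta (Hs j) s y|)) m.*2.+1.
  rewrite card_ord => h; apply: (le_trans (h _)) => [j|].
    by rewrite mulr_ge0 // addr_ge0 // divr_ge0.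
  rewrite -doubleS -/q ler_wpM2l ?exprn_ge0 //; apply: ler_sum => j _.
  rewrite exprMn ler_wpM2l ?exprn_ge0 //.
  apply: (le_trans (expr_add_le q (divr_ge0 _ (ltW n0)) (normr_ge0 _))) => //.
  rewrite ler_wpM2l ?exprn_ge0 // lerD //.
    rewrite exprMn ler_wpM2l ?exprn_ge0 // exprVn lef_pV2 ?posrE ?exprn_gt0 //.
    by rewrite ler_weXn2l // /q -muln2 leq_pmulr.
  by rewrite -normrX ger0_norm // exprn_even_ge0 // odd_double.
rewrite expectZ expect_sum -[leRHS]mulrA ler_wpM2l ?exprn_ge0 // mulr_suml.
apply: ler_sum => j _; rewrite expectZ expectZ /D -[leRHS]mulrA.
rewrite -[X in _ <= _ * X]mulrA ler_wpM2l ?exprn_ge0 //.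
rewrite ler_wpM2l ?exprn_ge0 // expectD expect_cst ?ergm_pmf_sum1 //.
by rewrite mulrDl lerD2l; case: (hC j) => _; apply.
Qed.

End NoiseMoments.

(** * Contraction *)

Section Contraction.
Variables (R : realType) (k : nat) (Hs : 'I_k -> sgraph) (beta : 'I_k -> R).
(** A negative coefficient is possible only for a single edge. Such a graph has no other edges to
    place, so its term in the local field is independent of the densities and the field remains
    monotone in them. *)
Hypothesis beta_cases : forall j, ne (Hs j) = 1%N \/ 0 <= beta j.

Local Notation Phi := (Phi Hs beta).
Local Notation phi := (phi Hs beta).
Local Notation cond_prob := (@cond_prob R k Hs beta _).
Local Notation field_error := (@field_error R k Hs beta _).

Section Fixed.
Variable n : nat.
Implicit Types (s t u : opair n) (y : config n).

Lemma two_Phi a :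
  2 * Phi a = \sum_(j < k) beta j * ((2 * ne (Hs j))%:R * a ^+ (ne (Hs j) - 1)).
Proof.
by rewrite /Phi mulr_sumr; apply: eq_bigr => j _; rewrite natrM -!mulrA mulrCA.
Qed.

Lemma local_fieldE s y : local_field Hs beta s y = \sum_(j < k)
  beta j * (sub_density (Hs j) (cond_prob^~ y) s +
            graph_noise Hs beta (Hs j) s y).
Proof. by apply: eq_bigr => j _; rewrite (scale_nhom_at_noise Hs beta). Qed.

(* The local field if every conditional probability were [a], the noise being
   kept as it is. *)
Definition uniform_field s y a : R := \sum_(j < k)
  beta j * (scale R n (Hs j) * #|@placed (Hs j) n s|%:R * a ^+ (ne (Hs j) - 1) +
            graph_noise Hs beta (Hs j) s y).

Lemma uniform_field_near s y a : 0 <= a <= 1 ->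
  `|uniform_field s y a - 2 * Phi a| <= field_error s y.
Proof.
move=> /andP[a0 a1]; rewrite two_Phi -sumrB (le_trans (ler_norm_sum _ _ _)) //.
apply: ler_sum => j _; rewrite -mulrBr normrM ler_wpM2l // addrAC -mulrBl.
rewrite (le_trans (ler_normD _ _)) // lerD2r normrM -[leRHS]mulr1.
apply: ler_pM => //; first exact: scale_card_placed.
by rewrite ger0_norm ?exprn_ge0 // exprn_ile1.
Qed.

Lemma sub_density_no_pair (H : sgraph) (f : opair n -> R) s : ne H = 1%N ->
  sub_density H f s = scale R n H * #|@placed H n s|%:R.
Proof.
move=> ne1; rewrite /sub_density -sum1_card natr_sum; congr (_ * _).
apply: eq_bigr => i Di; have /size0nil -> : size (other_pairs s i) = 0%N.
  by rewrite size_other_pairs // ne1.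
by rewrite big_nil.
Qed.

Lemma local_field_le_uniform s y a : (forall u, cond_prob u y <= a) ->
  local_field Hs beta s y <= uniform_field s y a.
Proof.
move=> ca; have ca' u : 0 <= cond_prob u y <= a.
  by rewrite ca; case/andP: (cond_prob01 Hs beta u y) => ->.
rewrite local_fieldE; apply: ler_sum => j _; rewrite !mulrDr lerD2r.
case: (beta_cases j) => [ne1|b0]; last by rewrite ler_wpM2l // sub_density_mono.
by rewrite sub_density_no_pair // ne1 expr0 mulr1.
Qed.

Lemma local_field_ge_uniform s y a : 0 <= a -> (forall u, a <= cond_prob u y) ->
  uniform_field s y a <= local_field Hs beta s y.
Proof.
move=> a0 ca; rewrite local_fieldE; apply: ler_sum => j _; rewrite !mulrDr lerD2r.
case: (beta_cases j) => [ne1|b0]; last by rewrite ler_wpM2l // sub_density_mono_ge.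
by rewrite sub_density_no_pair // ne1 expr0 mulr1.
Qed.

(* The extreme conditional probabilities are almost a sub- and a
   super-solution of the fixed point equation. *)
Lemma cond_prob_confined p eps eta y :
  (forall a, a <= 1 -> a <= phi a + eta -> a <= p + eps) ->
  (forall a, 0 <= a -> phi a - eta <= a -> p - eps <= a) ->
  (forall s, field_error s y <= eta) ->
  forall s, `|cond_prob s y - p| <= eps.
Proof.
move=> above below err s0.
have near s a : 0 <= a <= 1 -> `|sigm (uniform_field s y a) - phi a| <= eta.
  move=> a01; apply: le_trans (err s); apply: le_trans (uniform_field_near s y a01).
  exact: sigm_lip.
have [hi hiP] := finite_max (cond_prob^~ y) s0.
have [lo loP'] := finite_max (fun u => - cond_prob u y) s0.
have loP u : cond_prob lo y <= cond_prob u y by rewrite -lerN2 loP'.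
have /andP[hi0 hi1] := cond_prob01 Hs beta hi y.
have /andP[lo0 lo1] := cond_prob01 Hs beta lo y.
have up : cond_prob hi y <= p + eps.
  apply: (above _ hi1); apply: (le_trans (ler_sigm (local_field_le_uniform hi hiP))).
  by rewrite -lerBlDl; case/ler_normlP: (near hi _ (introT andP (conj hi0 hi1))).
have down : p - eps <= cond_prob lo y.
  apply: (below _ lo0); apply: le_trans (ler_sigm (local_field_ge_uniform lo lo0 loP)).
  rewrite lerBlDr -lerBlDl -[leLHS]opprB.
  by case/ler_normlP: (near lo _ (introT andP (conj lo0 lo1))).
by rewrite ler_distl (le_trans down (loP s0)) (le_trans (hiP s0) up).
Qed.

(** A matrix bounding the linearised density map near [p]: the slope of [sigm] is replaced by its
    bound, and all densities but the one at [t] by [p + eps]. Its row sums are at most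
    [contraction_rate]. *)
Definition influence p eps s t : R := (p * (1 - p) + eps) * \sum_(j < k)
  `|beta j| * ((p + eps) ^+ (ne (Hs j) - 1).-1 * spread_kernel R (Hs j) s t).

Lemma influence_ge0 p eps s t : 0 <= p <= 1 -> 0 <= eps -> 0 <= influence p eps s t.
Proof.
move=> /andP[p0 p1] e0.
apply: mulr_ge0; first by rewrite addr_ge0 // mulr_ge0 // subr_ge0.
apply: sumr_ge0 => j _; rewrite mulr_ge0 // mulr_ge0 ?spread_kernel_ge0 //.
by rewrite exprn_ge0 // addr_ge0.
Qed.

Lemma sum_influence p eps s : 0 <= p <= 1 -> 0 <= eps ->
  \sum_t influence p eps s t <= contraction_rate Hs beta p eps.
Proof.
move=> /andP[p0 p1] e0; rewrite -mulr_sumr ler_wpM2l //.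
  by rewrite addr_ge0 // mulr_ge0 // subr_ge0.
rewrite exchange_big /dPhi mulr_sumr; apply: ler_sum => j _.
rewrite -mulr_sumr -mulr_sumr.
apply: (@le_trans _ _ (`|beta j| * ((p + eps) ^+ (ne (Hs j) - 1).-1 *
   ((2 * ne (Hs j))%:R * (ne (Hs j) - 1)%:R)))).
  by rewrite !ler_wpM2l ?exprn_ge0 ?addr_ge0 // sum_spread_kernel.
case: (beta_cases j) => [->|b0]; first by rewrite subnn !(mul0r, mulr0).
rewrite ger0_norm // natrM.
move: (_ ^+ _) (ne (Hs j))%:R (_ - _)%:R => x e e'.
by rewrite le_eqVlt; apply/orP; left; apply/eqP; ring.
Qed.

Lemma cond_prob_contract p eps y : 0 <= p <= 1 -> phi p = p -> 0 <= eps ->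
  (forall s, `|cond_prob s y - p| <= eps) ->
  forall s, `|cond_prob s y - p| <=
    \sum_t influence p eps s t * `|cond_prob t y - p| +
    (p * (1 - p) + eps) * field_error s y.
Proof.
move=> p01 pp e0 near s; have /andP[p0 p1] := p01.
have kap0 : 0 <= p * (1 - p) + eps by rewrite addr_ge0 // mulr_ge0 // subr_ge0.
have := @sigm_lip_near R p eps (local_field Hs beta s y) (2 * Phi p) p01 (near s).
rewrite -phiE pp subrr normr0 => /(_ e0) /le_trans; apply.
rewrite /influence; under eq_bigr do rewrite -mulrA.
rewrite -mulr_sumr -mulrDr ler_wpM2l //.
under eq_bigr do rewrite mulr_suml.
rewrite exchange_big -big_split /= local_fieldE two_Phi -sumrB.
rewrite (le_trans (ler_norm_sum _ _ _)) //; apply: ler_sum => j _.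
rewrite -mulrBr normrM.
under eq_bigr do rewrite -mulrA -mulrA.
rewrite -mulr_sumr -mulr_sumr -[leRHS]mulrDr ler_wpM2l // addrAC addrA.
rewrite (le_trans (ler_normD _ _)) // lerD2r.
apply: sub_density_near => [u||//]; last by rewrite p0 lerDl.
rewrite (andP (cond_prob01 Hs beta u y)).1 /=.
by have /ler_normlP[_] := near u; lra.
Qed.

End Fixed.
End Contraction.

(** * Moment bounds *)

Lemma ler_cube (R : realType) (x y : R) : 0 <= x -> x <= y -> x ^+ 3 <= y ^+ 3.
Proof. by move=> x0 xy; apply: lerXn2r; rewrite ?nnegrE // (le_trans x0). Qed.

(** The exchangeable pair argument supplies even moments only. With [r] of order n^{-1/2}, a fourth
    moment O(n^{-2}) gives a third moment O(n^{-3/2}). *)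
Lemma cube_le_fourth (R : realType) (x r : R) : 0 <= x -> 0 < r ->
  x ^+ 3 <= x ^+ 4 / r + r ^+ 3.
Proof.
move=> x0 r0; have [xr|rx] := leP x r.
  apply: (@le_trans _ _ (r ^+ 3)); last by rewrite lerDr divr_ge0 ?exprn_ge0 // ltW.
  by apply: lerXn2r; rewrite ?nnegrE // ltW.
apply: (@le_trans _ _ (x ^+ 4 / r)); last by rewrite lerDl exprn_ge0 // ltW.
by rewrite ler_pdivlMr // [x ^+ 4]exprSr ler_wpM2l ?exprn_ge0 // ltW.
Qed.

Lemma card_opair n : (#|{: opair n}| <= n ^ 2)%N.
Proof.
have <- : #|{: 'I_n * 'I_n}| = (n ^ 2)%N by rewrite card_prod card_ord mulnn.
by apply: (@leq_card _ _ (val : opair n -> _)); exact: val_inj.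
Qed.

Section EdgeMoment.
Variables (R : realType) (k : nat) (Hs : 'I_k -> sgraph) (beta : 'I_k -> R).
Hypothesis beta_cases : forall j, ne (Hs j) = 1%N \/ 0 <= beta j.

Definition rate (n : nat) : R := Num.sqrt n%:R^-1.

Lemma rate_gt0 n (s : opair n) : 0 < rate n.
Proof. by rewrite sqrtr_gt0 invr_gt0 ltr0n (opair_gt0 s). Qed.

Lemma rate_sqr n : rate n ^+ 2 = n%:R^-1.
Proof. by rewrite sqr_sqrtr // invr_ge0. Qed.

Lemma rate_le1 n : rate n <= 1.
Proof.
rewrite -sqrtr1; apply: ler_wsqrtr.
case: n => [|n]; first by rewrite invr0.
by rewrite invf_le1 ?ltr0n // ler1n.
Qed.

Lemma expect_cube_le (C : R) n (s : opair n) (X : config n -> R) :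
  (forall y, 0 <= X y) ->
  ergm_E Hs beta (fun y => X y ^+ 4) <= C / n%:R ^+ 2 ->
  ergm_E Hs beta (fun y => X y ^+ 3) <= (C + 1) * rate n ^+ 3.
Proof.
move=> X0; have r0 := rate_gt0 s; rewrite !ergm_expect => X4.
apply: (@le_trans _ _ (expect (@ergm_pmf R k Hs beta n)
    (fun y => (rate n)^-1 * X y ^+ 4 + rate n ^+ 3))).
  apply: (le_expect (@ergm_pmf_ge0 _ _ _ _ _)) => y.
  by rewrite mulrC; exact: cube_le_fourth.
rewrite expectD expectZ expect_cst ?ergm_pmf_sum1 // mulrDl mul1r lerD2r.
apply: (le_trans (ler_wpM2l _ X4)); first by rewrite invr_ge0 ltW.
rewrite -exprVn -rate_sqr.
by rewrite le_eqVlt; apply/orP; left; apply/eqP; field; rewrite gt_eqF.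
Qed.

Variable p : R.
Hypothesis p01 : 0 < p < 1.
Hypothesis phi_p : phi Hs beta p = p.
Hypothesis phi_fix : forall q : R, 0 < q < 1 -> phi Hs beta q = q -> q = p.
Hypothesis dphi_p : derive1 (phi Hs beta) p < 1.

Local Notation cond_prob := (@cond_prob R k Hs beta _).
Local Notation field_error := (@field_error R k Hs beta _).

Lemma cond_prob_moment : exists2 C : R, 0 <= C & forall n (s : opair n),
  ergm_E Hs beta (fun y => `|cond_prob s y - p| ^+ 3) <= C * rate n ^+ 3.
Proof.
have /andP[p0 p1] := p01.
have p01' : 0 <= p <= 1 by rewrite !ltW.
have [eps e0 rate1] := contraction_rate_lt1 phi_p dphi_p.
have [eta1 eta1_0 above] := phi_gap_above phi_fix e0.
have [eta2 eta2_0 below] := phi_gap_below phi_fix e0.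
pose eta := Num.min eta1 eta2.
have eta0 : 0 < eta by rewrite lt_min eta1_0.
have [C4 C40 hC4] := field_error_moment Hs beta 1.
(* Order eight, as the sum over at most n^2 pairs of terms O(n^{-4}) is O(n^{-2}), within the target
   n^{-3/2}; order six would leave only O(n^{-1}). *)
have [C8 C80 hC8] := field_error_moment Hs beta 3.
set theta := contraction_rate Hs beta p eps in rate1.
pose kap := p * (1 - p) + eps.
have kap0 : 0 <= kap by rewrite addr_ge0 ?ltW // mulr_gt0 // subr_gt0.
have th0 : 0 < 1 - theta by rewrite subr_gt0.
pose K1 := kap ^+ 3 / (1 - theta) ^+ 2.
have K10 : 0 <= K1 by rewrite divr_ge0 ?exprn_ge0 // ltW.
pose K := K1 * (C4 + 1) + C8 / eta ^+ 8.
have K0 : 0 <= K.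
  rewrite addr_ge0 //; first by rewrite mulr_ge0 // addr_ge0.
  by rewrite divr_ge0 // exprn_ge0 // ltW.
exists (K / (1 - theta)); first by rewrite divr_ge0 // ltW.
move=> n s0.
(* One inequality for both events: if all errors are at most [eta], contraction applies; otherwise
   some error makes the last sum at least 1, which bounds the left-hand side trivially. *)
have pointwise (s : opair n) (y : config n) : `|cond_prob s y - p| ^+ 3 <=
   \sum_t influence Hs beta p eps s t * `|cond_prob t y - p| ^+ 3 +
   (K1 * field_error s y ^+ 3 + \sum_t (eta ^+ 8)^-1 * field_error t y ^+ 8).
  have inf0 t : 0 <= influence Hs beta p eps s t.
    by apply: influence_ge0 => //; exact: ltW.
  have err0 t := field_error_ge0 Hs beta t y.
  have sum3 : 0 <= \sum_t influence Hs beta p eps s t * `|cond_prob t y - p| ^+ 3.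
    by apply: sumr_ge0 => t _; rewrite mulr_ge0 ?exprn_ge0.
  have sum8 : 0 <= \sum_t (eta ^+ 8)^-1 * field_error t y ^+ 8.
    by apply: sumr_ge0 => t _; rewrite mulr_ge0 ?invr_ge0 ?exprn_ge0 // ltW.
  have [/forallP small|/forallPn[t]] := boolP [forall t, field_error t y <= eta].
    have near := @cond_prob_confined _ _ Hs beta beta_cases n p eps eta y.
    have {}near : forall t, `|cond_prob t y - p| <= eps.
      apply: near => [a a1 h|a a0 h|//].
        by apply: above => //; apply: (le_trans h); rewrite lerD2l ge_min lexx.
      by apply: below => //; apply: le_trans h; rewrite lerD2l lerN2 ge_min lexx orbT.
    have contr := cond_prob_contract p01' phi_p (ltW e0) near s.
    have suminf := sum_influence beta_cases s p01' (ltW e0).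
    have theta0 : 0 <= theta by apply: le_trans suminf; apply: sumr_ge0.
    (* The weights [theta] and [1 - theta] add up to 1, so cubing puts no factor in front of the
       influence sum and the contraction is preserved. *)
    have := jensen_cube inf0 (fun t => normr_ge0 (cond_prob t y - p)) theta0 th0
      (mulr_ge0 kap0 (err0 s)) suminf.
    rewrite [theta + _]addrC subrK expr1n mul1r => jen.
    apply: (le_trans (ler_cube (normr_ge0 _) contr)).
    apply: (le_trans jen); rewrite lerD2l exprMn mulrAC.
    by rewrite lerDl.
  rewrite -ltNge => big.
  apply: (@le_trans _ _ 1).
    rewrite exprn_ile1 //; have /andP[c0 c1] := cond_prob01 Hs beta s y.
    by rewrite ler_distl; apply/andP; split; lra.
  apply: (@le_trans _ _ (\sum_t (eta ^+ 8)^-1 * field_error t y ^+ 8)).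
    rewrite (bigD1 t) //= -[leLHS]addr0 lerD //.
      rewrite mulrC ler_pdivlMr ?exprn_gt0 // mul1r.
      by apply: lerXn2r; rewrite ?nnegrE // ltW.
    by apply: sumr_ge0 => u _; rewrite mulr_ge0 ?invr_ge0 ?exprn_ge0 // ltW.
  by rewrite addrA lerDr addr_ge0 // mulr_ge0 // exprn_ge0.
pose M (s : opair n) := expect (@ergm_pmf R k Hs beta n) (fun y => `|cond_prob s y - p| ^+ 3).
have r0 := rate_gt0 s0.
have step s : M s <= \sum_t influence Hs beta p eps s t * M t + K * rate n ^+ 3.
  rewrite /M.
  apply: (le_trans (le_expect (@ergm_pmf_ge0 _ _ _ _ _) (pointwise s))).
  rewrite !expectD expectZ !expect_sum; apply: lerD.
    by apply: ler_sum => t _; rewrite expectZ.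
  rewrite /K mulrDl; apply: lerD.
    rewrite -mulrA ler_wpM2l //.
    exact: (expect_cube_le s (field_error_ge0 Hs beta s) (hC4 n s)).
  apply: (@le_trans _ _ (\sum_(t : opair n) (eta ^+ 8)^-1 * (C8 / n%:R ^+ 4))).
    apply: ler_sum => t _; rewrite expectZ ler_wpM2l ?invr_ge0 ?exprn_ge0 ?(ltW eta0) //.
    exact: (hC8 n t).
  have n0 : 0 < n%:R :> R by rewrite ltr0n (opair_gt0 s).
  have count (N : R) : N <= n%:R ^+ 2 ->
      N * ((eta ^+ 8)^-1 * (C8 / n%:R ^+ 4)) <= C8 / eta ^+ 8 * rate n ^+ 3.
    move=> Nn.
    have -> : N * ((eta ^+ 8)^-1 * (C8 / n%:R ^+ 4)) =
      C8 / eta ^+ 8 * (N / n%:R ^+ 4) by ring.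
    rewrite ler_wpM2l ?divr_ge0 ?exprn_ge0 ?(ltW eta0) //.
    apply: (@le_trans _ _ (n%:R ^+ 2 / n%:R ^+ 4)).
      by rewrite ler_wpM2r ?invr_ge0 ?exprn_ge0 ?(ltW n0).
    have -> : n%:R ^+ 2 / n%:R ^+ 4 = rate n ^+ 4.
      by rewrite (exprM (rate n) 2 2) rate_sqr; field; rewrite gt_eqF.
    by rewrite exprS -[leRHS]mul1r ler_wpM2r ?exprn_ge0 ?(ltW r0) // rate_le1.
  rewrite sumr_const -[leLHS]mulr_natl; apply: count.
  by rewrite -natrX ler_nat; exact: (leq_trans (max_card _) (card_opair n)).
(* At the pair with the largest moment, the row sums bound the influence term by [theta * M smax],
   which is absorbed on the left because [theta < 1]. *)
have [smax sP] := finite_max M s0.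
have Mmax0 : 0 <= M smax.
  by apply: (expect_ge0 (@ergm_pmf_ge0 _ _ _ _ _)) => y; rewrite exprn_ge0.
have : M smax <= theta * M smax + K * rate n ^+ 3.
  apply: (le_trans (step smax)); rewrite lerD2r.
  apply: (@le_trans _ _ (\sum_t influence Hs beta p eps smax t * M smax)).
    apply: ler_sum => t _; rewrite ler_wpM2l //.
    by apply: influence_ge0 => //; exact: ltW.
  rewrite -mulr_suml ler_wpM2r //.
  exact: (sum_influence beta_cases smax p01' (ltW e0)).
move=> h; apply: (le_trans (sP s0)).
rewrite mulrAC ler_pdivlMr // mulrBr mulr1 lerBlDr [_ * theta]mulrC addrC //.
Qed.

Variable H : sgraph.

(** No contraction is required for [H] itself, so densities are bounded by 1 and any total weight of
    the kernel is acceptable; convexity is used with the arbitrary choice [gamma = 1]. *)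
Lemma nhom_at_moment : exists2 C : R, 0 <= C & forall n (s : opair n),
  ergm_E Hs beta (fun y =>
    `|scale R n H * (nhom_at H (graph_of y) (pair_set s))%:R -
      (2 * ne H)%:R * p ^+ (ne H - 1)| ^+ 3) <= C * rate n ^+ 3.
Proof.
have /andP[p0 p1] := p01.
have [C1 C10 hC1] := cond_prob_moment.
have [C4 C40 hC4] := graph_noise_moment Hs beta H 2.
pose T : R := (2 * ne H)%:R * (ne H - 1)%:R.
have T0 : 0 <= T by rewrite mulr_ge0.
pose cc : R := (count_cst H)%:R.
pose K := (T + 1) ^+ 2 * (T * C1 + 2 ^+ 3 * (cc ^+ 3 + (C4 + 1))).
exists K.
  rewrite mulr_ge0 ?sqr_ge0 // addr_ge0 ?mulr_ge0 ?exprn_ge0 //.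
  by rewrite !addr_ge0 // exprn_ge0.
move=> n s; have r0 := rate_gt0 s.
pose b y := cc / n%:R + `|graph_noise Hs beta H s y|.
have b0 y : 0 <= b y by rewrite addr_ge0 // divr_ge0.
have ker0 t : 0 <= spread_kernel R H s t by exact: spread_kernel_ge0.
rewrite ergm_expect.
apply: (@le_trans _ _ (expect (@ergm_pmf R k Hs beta n) (fun y =>
  (T + 1) ^+ 2 * (\sum_t spread_kernel R H s t * `|cond_prob t y - p| ^+ 3 +
   2 ^+ 3 * ((cc * rate n) ^+ 3 + `|graph_noise Hs beta H s y| ^+ 3))))).
  apply: (le_expect (@ergm_pmf_ge0 _ _ _ _ _)) => y.
  have dist : `|scale R n H * (nhom_at H (graph_of y) (pair_set s))%:R -
      (2 * ne H)%:R * p ^+ (ne H - 1)| <=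
      \sum_t spread_kernel R H s t * `|cond_prob t y - p| + b y.
    rewrite (scale_nhom_at_noise Hs beta) addrAC (le_trans (ler_normD _ _)) //.
    rewrite /b addrA lerD2r.
    have := @sub_density_near R n H (cond_prob^~ y) s p 1 (fun u => cond_prob01 Hs beta u y).
    rewrite expr1n mul1r; apply => //; last exact: ltW.
    by rewrite !ltW.
  apply: (le_trans (ler_cube (normr_ge0 _) dist)).
  apply: (le_trans (jensen_cube ker0 (fun t => normr_ge0 (cond_prob t y - p)) T0
    ltr01 (b0 y) (sum_spread_kernel R H s))).
  rewrite expr1n divr1 ler_wpM2l ?sqr_ge0 // lerD2l.
  apply: (le_trans (expr_add_le 3 _ (normr_ge0 _))); first by rewrite divr_ge0.
  rewrite ler_wpM2l ?exprn_ge0 // lerD2r.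
  apply: lerXn2r; rewrite ?nnegrE ?divr_ge0 ?mulr_ge0 ?(ltW r0) //.
  rewrite ler_wpM2l // -rate_sqr expr2 -[leRHS]mul1r ler_wpM2r ?(ltW r0) //.
  exact: rate_le1.
rewrite expectZ expectD expect_sum expectZ expectD expect_cst ?ergm_pmf_sum1 //.
rewrite /K -[leRHS]mulrA ler_wpM2l ?sqr_ge0 // [leRHS]mulrDl; apply: lerD.
  apply: (@le_trans _ _ (\sum_t spread_kernel R H s t * (C1 * rate n ^+ 3))).
    by apply: ler_sum => t _; rewrite expectZ ler_wpM2l //; exact: hC1.
  rewrite -mulr_suml -[leRHS]mulrA ler_wpM2r ?sum_spread_kernel //.
  by rewrite mulr_ge0 // exprn_ge0 // ltW.
rewrite -[leRHS]mulrA ler_wpM2l ?exprn_ge0 // [leRHS]mulrDl exprMn lerD2l.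
apply: (expect_cube_le s); first by move=> y; exact: normr_ge0.
apply: le_trans (hC4 n s).
rewrite ergm_expect; apply: (le_expect (@ergm_pmf_ge0 _ _ _ _ _)) => y.
by rewrite -normrX ger0_norm // exprn_even_ge0.
Qed.

End EdgeMoment.

(** The constant is 8 (1 + 4): 8 splits the cube of a sum, and 4 is the cost of bounding the
    distance from the mean to [c] by [jensen_cube] with [t = gamma = 1]. *)
Lemma expect_central_cube (R : realType) (T : finType)
    (P X : {ffun T -> bool} -> R) (c : R) :
  (forall y, 0 <= P y) -> \sum_y P y = 1 ->
  expect P (fun y => `|X y - expect P X| ^+ 3) <=
  40 * expect P (fun y => `|X y - c| ^+ 3).
Proof.
move=> P0 P1; set e := expect P X; set A := expect P (fun y => `|X y - c| ^+ 3).
have ec : `|e - c| ^+ 3 <= 4 * A.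
  have le_ec : `|e - c| <= \sum_y P y * `|X y - c| + 0.
    rewrite addr0 -[c in `|e - c|](expect_cst P1) -mulN1r -expectZ -expectD.
    rewrite (le_trans (norm_expect P0 _)) //.
    apply: (le_expect P0) => y. by rewrite mulN1r.
  apply: (le_trans (ler_cube (normr_ge0 _) le_ec)).
  have := jensen_cube P0 (fun y => normr_ge0 (X y - c)) ler01 ltr01 (lexx (0 : R)).
  rewrite P1 => /(_ (lexx _)); rewrite expr0n /= mul0r !addr0.
  by rewrite (_ : (1 + 1) ^+ 2 = 4 :> R) //; ring.
apply: (@le_trans _ _ (expect P (fun y => 8 * (`|X y - c| ^+ 3 + `|e - c| ^+ 3)))).
  apply: (le_expect P0) => y.
  have tri : `|X y - e| <= `|X y - c| + `|e - c|.
    by rewrite (distrC e) (le_trans _ (ler_normD _ _)) // addrA subrK.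
  apply: (le_trans (ler_cube (normr_ge0 _) tri)).
  have := expr_add_le 3 (normr_ge0 (X y - c)) (normr_ge0 (e - c)).
  by rewrite (_ : 2 ^+ 3 = 8 :> R) // -natrX.
rewrite expectZ expectD expect_cst // -/A; lra.
Qed.

Theorem lemma5p2 (R : realType) (k : nat) (Hs : 'I_k -> sgraph)
    (beta : 'I_k -> R)
    (k_ge1 : (1 <= k)%N)
    (Hs_first : forall j : 'I_k, nat_of_ord j = 0%N -> is_single_edge (Hs j))
    (Hs_rest : forall j : 'I_k, (0 < j)%N ->
       [/\ no_isolated (Hs j), (2 <= ne (Hs j))%N & 0 < beta j])
    (beta_sub : subcritical Hs beta)
    (H : sgraph) (H_edge : (1 <= ne H)%N) :
  exists C : R, forall n : nat, (2 <= n)%N ->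
    forall i j : 'I_n, (i < j)%N ->
    let X := fun y : config n =>
      (nhom_at H (graph_of y) [set i; j]%SET)%:R : R in
    ergm_E Hs beta (fun y : config n => `|X y - ergm_E Hs beta X| ^+ 3)
      <= C * n%:R `^ (3 * (nv H)%:R - 15 / 2).
Proof.
have cases j : ne (Hs j) = 1%N \/ 0 <= beta j.
  have [/Hs_first[_ ->]|/Hs_rest[_ _ /ltW]] := posnP j; by [left|right].
have [p [p01 pp puniq dp]] := beta_sub.
have [C C0 hC] := nhom_at_moment cases p01 pp puniq dp H.
exists (40 * C) => n n2 i j ij.
pose X (y : config n) : R := (nhom_at H (graph_of y) [set i; j]%SET)%:R.
change (ergm_E Hs beta (fun y => `|X y - ergm_E Hs beta X| ^+ 3)
  <= 40 * C * n%:R `^ (3 * (nv H)%:R - 15 / 2)).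
pose s : opair n := Sub (i, j) ij.
have n0 : 0 < n%:R :> R by rewrite ltr0n (leq_trans _ n2).
have v2 : (2 <= nv H)%N.
  have [a aH] : exists a, a \in edges H by apply/card_gt0P.
  by rewrite -(edges_card2 aH) max_card.
pose N : R := n%:R ^+ (nv H - 2).
have N0 : 0 < N by rewrite exprn_gt0.
have XE y : X y = N * (scale R n H * (nhom_at H (graph_of y) (pair_set s))%:R).
  by rewrite mulrA /scale divff ?mul1r // gt_eqF.
pose c := N * ((2 * ne H)%:R * p ^+ (ne H - 1)).
(* The exponents match as 3(v-2) - 3/2 = 3v - 15/2; [v2] turns the truncated difference in [N] into
   a true one. *)
have -> : n%:R `^ (3 * (nv H)%:R - 15 / 2) = N ^+ 3 * rate R n ^+ 3.
  have rE : rate R n = n%:R `^ (- 2^-1).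
    by rewrite /rate powRN powR12_sqrt // sqrtrV.
  rewrite rE /N -!exprM -!powR_mulrn ?powR_ge0 // ?(ltW n0) // -powRrM -powRD.
    congr (_ `^ _); rewrite natrM natrB //; by field.
  by rewrite (gt_eqF n0) implybT.
apply: (le_trans (expect_central_cube X c (@ergm_pmf_ge0 R k Hs beta n)
  (ergm_pmf_sum1 Hs beta n))).
rewrite -mulrA ler_wpM2l // mulrCA.
apply: le_trans (ler_wpM2l (exprn_ge0 3 (ltW N0)) (hC n s)).
rewrite ergm_expect -expectZ; apply: (le_expect (@ergm_pmf_ge0 _ _ _ _ _)) => y.
by rewrite XE /c -mulrBr normrM (ger0_norm (ltW N0)) exprMn.
Qed.
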